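(* Let $M$ be a compact manifold with a foliation $\mathcal{F}$ and let $P:C^\infty(M)\to C^\infty(M)$ be a basic transversely elliptic operator of order $m\ge 2$. If there exists a complete transversal $\mathcal{T}$ of $\mathcal{F}$ satisfying the Assumption (stated in the context) on which $P$ has constant coefficients, then $\mathcal{F}$ is a Riemannian foliation.
   Context: All manifolds and maps are $C^\infty$; $C^\infty(M)$ denotes complex-valued smooth functions. Let $p=\dim\mathcal F$, $q=\operatorname{codim}\mathcal F$. A foliated chart has coordinates $(x,y)=(x_1,\dots,x_p,y_1,\dots,y_q)$ with $\mathcal F$ given locally by $dy_1=\cdots=dy_q=0$. Basic operator: $P$ of order $m$ is basic if at each point of $M$ there is a foliated chart $(x,y)$ in which $P=\sum_{|s|=0}^m a_s(y)\,\frac{\partial^{|s|}}{\partial y_1^{s_1}\cdots\partial y_q^{s_q}}$ (form (1)), $s\in\mathbb N^q$, with $a_s$ smooth complex-valued functions of $y$ only. $P$ is transversely elliptic if for every point, in form (1), $\sigma(P)(\xi)=\sum_{|s|=m}a_s(y)\xi_1^{s_1}\cdots\xi_q^{s_q}\neq0$ for every nonzero covector $\xi\in(\nu\mathcal F)^*$ (covectors vanishing on $T\mathcal F$). Transversals: a transversal is a $q$-dimensional submanifold $\mathcal T$ with $T_z\mathcal T\cap T_z\mathcal F=\{0\}$ for all $z\in\mathcal T$; a complete transversal is an immersed (not necessarily connected) one meeting every leaf. In a foliated chart where $P$ has form (1), a vertical subspace is a subspace defined by $dx_1=\cdots=dx_p=0$. A transversal is compatible with $P$ if at each of its points there is such a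 foliated chart $U$ in which its intersection with $U$ lies in a vertical subspace. Assumption on $\mathcal T=\bigsqcup_{i\in I}\mathcal T_i$: (1) $\mathcal T$ has finitely many open connected components $\mathcal T_i$; (2) each $\mathcal T_i$ is a relatively compact subset of a transversal $\mathcal T_i'$; (3) each $\mathcal T_i'$ is compatible with $P$ and lies in a foliated chart where $P$ has form (1). $P$ has constant coefficients at $z\in M$ if there is a foliated chart at $z$ in which $P$ has form (1) with all $a_s$ constant; $P$ has constant coefficients on a subset of $M$ if it does at each of its points. Riemannian foliation: the normal bundle $\nu\mathcal F=TM/T\mathcal F$ carries a transverse (holonomy-invariant) metric; equivalently, on some complete transversal there is a Riemannian metric for which all holonomy transformations (Haefliger cocycles) are isometries. *)

(* Defs.v *)
(* MathComp-Analysis: the real numbers are an arbitrary [R : realType], the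
   complex numbers are [R[i]]. *)
From HB Require Import structures.
From Stdlib Require Import Relation_Operators.
From mathcomp Require Import all_boot all_order all_algebra.
From mathcomp Require Import all_classical all_reals all_analysis.
From mathcomp Require Import complex.

Set Implicit Arguments.
Unset Strict Implicit.
Unset Printing Implicit Defensive.

Import Order.TTheory GRing.Theory Num.Theory.
Import numFieldNormedType.Exports.

Local Open Scope classical_set_scope.
Local Open Scope ring_scope.

Section SmoothFunctions.
Context {R : realType} {n : nat}.

Definition partial (i : 'I_n) (f : 'rV[R]_n -> R) (x : 'rV[R]_n) : R :=
  'D_(delta_mx 0 i) f x.

(* [D] is meant to be open: then only the germ of [f] along [D] matters. *)
Definition smooth_on (D : set 'rV[R]_n) (f : 'rV[R]_n -> R) : Prop :=
  forall (l : seq 'I_n) (x : 'rV[R]_n), D x ->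
    {for x, continuous (foldr partial f l)} /\
    (forall i, derivable (foldr partial f l) x (delta_mx 0 i)).

Definition smooth_on_C (D : set 'rV[R]_n) (f : 'rV[R]_n -> R[i]) : Prop :=
  smooth_on D (fun x => complex.Re (f x)) /\
  smooth_on D (fun x => complex.Im (f x)).

Definition partial_C (i : 'I_n) (f : 'rV[R]_n -> R[i]) (x : 'rV[R]_n) : R[i] :=
  Complex (partial i (fun t => complex.Re (f t)) x)
          (partial i (fun t => complex.Im (f t)) x).

End SmoothFunctions.

(* A homeomorphism of the open set [chart_dom] of [M] onto an open set of R^n; [chart_inv]
   is its inverse, and is irrelevant outside [chart_map @` chart_dom]. *)
Record chart (R : realType) (n : nat) (M : topologicalType) := Chart {
  chart_dom : set M;
  chart_map :> M -> 'rV[R]_n;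
  chart_inv : 'rV[R]_n -> M;
  chart_dom_open : open chart_dom;
  chart_image_open : open (chart_map @` chart_dom);
  chart_mapK : forall z, chart_dom z -> chart_inv (chart_map z) = z;
  chart_map_continuous : forall z, chart_dom z -> {for z, continuous chart_map};
  chart_inv_continuous : forall x, (chart_map @` chart_dom) x -> {for x, continuous chart_inv} }.

Definition chart_image (R : realType) (n : nat) (M : topologicalType)
  (c : chart R n M) : set 'rV[R]_n := [set c z | z in chart_dom c].

Definition smooth_transition (R : realType) (n : nat) (M : topologicalType)
    (c d : chart R n M) : Prop :=
  forall j : 'I_n,
    smooth_on [set c z | z in chart_dom c `&` chart_dom d] (fun x => d (chart_inv c x) 0 j).

Record manifold (R : realType) (n : nat) := Manifold {
  carrier :> topologicalType;
  manifold_hausdorff : hausdorff_space carrier;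
  manifold_second_countable : @second_countable carrier;
  atlas : set (chart R n carrier);
  atlas_cover : forall z : carrier, exists2 c, atlas c & chart_dom c z;
  atlas_smooth : forall c d, atlas c -> atlas d -> smooth_transition c d }.

Definition smooth_chart (R : realType) (n : nat) (M : manifold R n)
    (c : chart R n M) : Prop :=
  forall d, atlas d -> smooth_transition c d /\ smooth_transition d c.

Record Cinfty (R : realType) (n : nat) (M : manifold R n) := MkCinfty {
  Cinfty_fun :> M -> R[i];
  Cinfty_smooth : forall c : chart R n M, smooth_chart c ->
    smooth_on_C (chart_image c) (fun x => Cinfty_fun (chart_inv c x)) }.

Section FoliatedCoordinates.
Context {R : realType} {p q : nat} {M : topologicalType}.
Implicit Types c d : chart R (p + q) M.

(* The coordinates of a chart are read as (x_1, ..., x_p, y_1, ..., y_q). *)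
Definition xcoord c (z : M) : 'rV[R]_p := lsubmx (c z).
Definition ycoord c (z : M) : 'rV[R]_q := rsubmx (c z).

(* d y_1 = ... = d y_q = 0 and d y'_1 = ... = d y'_q = 0 define the same
   distribution on the overlap, i.e. each dy'_j vanishes on every d/dx_i. *)
Definition same_leaf_directions c d : Prop :=
  forall z, chart_dom c z -> chart_dom d z -> forall (i : 'I_p) (j : 'I_q),
    partial (lshift q i) (fun t => ycoord d (chart_inv c t) 0 j) (c z) = 0.

End FoliatedCoordinates.

(* A foliation of dimension p and codimension q, given by a foliated atlas. *)
Record foliation (R : realType) (p q : nat) (M : manifold R (p + q)) :=
  Foliation {
  fatlas : set (chart R (p + q) M);
  fatlas_smooth : forall c, fatlas c -> smooth_chart c;
  fatlas_cover : forall z : M, exists2 c, fatlas c & chart_dom c z;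
  fatlas_compat : forall c d, fatlas c -> fatlas d -> same_leaf_directions c d }.

Section Foliations.
Context {R : realType} {p q : nat} {M : manifold R (p + q)}.
Variable F : foliation M.
Implicit Types (c d : chart R (p + q) M) (S : set M) (z w : M).

Definition foliated_chart c : Prop :=
  smooth_chart c /\ (forall d, fatlas F d -> same_leaf_directions c d).

Definition plaque c z : set M :=
  connected_component (chart_dom c `&` [set w | ycoord c w = ycoord c z]) z.

(* Leaves are the classes of the equivalence relation generated by plaques. *)
Definition leaf z : set M :=
  clos_refl_sym_trans M
    (fun u v => exists c, [/\ foliated_chart c, chart_dom c u & plaque c u v]) z.

(* Tangent vectors at [z] are represented by their components [v] in a smooth
   chart [c] around [z]; [v] belongs to T_z F iff it is annihilated by the dy_j
   of the foliated charts. *)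
Definition tangent_foliation c z (v : 'rV[R]_(p + q)) : Prop :=
  forall d, foliated_chart d -> chart_dom d z -> forall j : 'I_q,
    'D_v (fun t => ycoord d (chart_inv c t) 0 j) (c z) = 0.

(* The first k coordinates of [c] parametrize [S], given by the vanishing of the
   others: if S contains z, then T_z S consists of the vectors whose components
   of index >= k in [c] are zero. *)
Definition slice_chart (k : nat) S c : Prop :=
  smooth_chart c /\
  (forall w, chart_dom c w -> (S w <-> forall i : 'I_(p + q), (k <= i)%N -> c w 0 i = 0)).

Definition submanifold (k : nat) S : Prop :=
  forall z, S z -> exists2 c, slice_chart k S c & chart_dom c z.

Definition transversal S : Prop :=
  submanifold q S /\
  (forall z c, S z -> slice_chart q S c -> chart_dom c z ->
    forall v : 'rV[R]_(p + q), (forall i : 'I_(p + q), (q <= i)%N -> v 0 i = 0) ->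
      tangent_foliation c z v -> v = 0).

(* The immersed transversal is the disjoint union of the [T i]; their images in
   [M] are allowed to meet. *)
Definition complete_transversal (I : Type) (T : I -> set M) : Prop :=
  (forall i, transversal (T i)) /\
  (forall z, exists i w, T i w /\ leaf z w).

(* A transverse metric: [g c z] is the matrix, in the frame d/dy_1, ..., d/dy_q
   of the normal bundle induced by the foliated chart [c], of a scalar product on
   the fibre at [z]. Holonomy invariance says that its entries depend locally
   on y only. *)
Record transverse_metric (g : chart R (p + q) M -> M -> 'M[R]_q) : Prop := {
  metric_smooth : forall c, foliated_chart c -> forall a b : 'I_q,
    smooth_on (chart_image c) (fun t => g c (chart_inv c t) a b);
  metric_sym : forall c z, foliated_chart c -> chart_dom c z -> (g c z)^T = g c z;
  metric_pos : forall c z, foliated_chart c -> chart_dom c z ->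
    forall u : 'rV[R]_q, u != 0 -> 0 < (u *m g c z *m u^T) 0 0;
  metric_change : forall c d z,
    foliated_chart c -> foliated_chart d -> chart_dom c z -> chart_dom d z ->
    let J := \matrix_(a < q, b < q)
      partial (rshift p b) (fun t => ycoord d (chart_inv c t) 0 a) (c z) in
    g c z = J^T *m g d z *m J;
  metric_holonomy : forall c z, foliated_chart c -> chart_dom c z ->
    forall (i : 'I_p) (a b : 'I_q),
      partial (lshift q i) (fun t => g c (chart_inv c t) a b) (c z) = 0 }.

Definition riemannian_foliation : Prop := exists g, transverse_metric g.

End Foliations.

Section MultiIndices.
Context {R : realType} {p q : nat}.
Variable m : nat.

(* Every s in N^q with |s| <= m has all its entries <= m. *)
Definition multi_index := {ffun 'I_q -> 'I_m.+1}.

Definition weight (s : multi_index) : nat := (\sum_(j < q) s j)%N.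

Definition partial_y (s : multi_index) (f : 'rV[R]_(p + q) -> R[i]) :
    'rV[R]_(p + q) -> R[i] :=
  foldr (fun j h => iter (s j) (partial_C (rshift p j)) h) f (enum 'I_q).

(* The principal symbol at a point with transverse coordinates y, evaluated on
   the covector xi_1 dy_1 + ... + xi_q dy_q; such covectors are exactly those
   vanishing on T F. *)
Definition symbol (a : multi_index -> 'rV[R]_q -> R[i]) (y xi : 'rV[R]_q) : R[i] :=
  \sum_(s : multi_index | weight s == m)
     a s y * \prod_(j < q) ((xi 0 j)%:C%C ^+ s j).

End MultiIndices.

Section BasicOperators.
Context {R : realType} {p q : nat} {M : manifold R (p + q)}.
Variables (F : foliation M) (m : nat) (P : Cinfty M -> Cinfty M).
Implicit Types (c : chart R (p + q) M) (S : set M) (z w : M).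

(* On [chart_dom c], P = sum_{|s| <= m} a_s(y) d^|s| / dy^s. *)
Definition basic_form c (a : multi_index m -> 'rV[R]_q -> R[i]) : Prop :=
  [/\ foliated_chart F c,
      forall s, (weight s <= m)%N ->
        smooth_on_C [set ycoord c z | z in chart_dom c] (a s)
    & forall (f : Cinfty M) z, chart_dom c z ->
        P f z = \sum_(s : multi_index m | (weight s <= m)%N)
          a s (ycoord c z) * partial_y s (fun t => f (chart_inv c t)) (c z)].

Definition basic_operator : Prop :=
  forall z, exists c a, chart_dom c z /\ basic_form c a.

Definition transversely_elliptic : Prop :=
  forall z c a, chart_dom c z -> basic_form c a ->
    forall xi : 'rV[R]_q, xi != 0 -> symbol a (ycoord c z) xi != 0.

Definition constant_coefficients_at z : Prop :=
  exists c (k : multi_index m -> R[i]), chart_dom c z /\ basic_form c (fun s _ => k s).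

Definition constant_coefficients_on S : Prop :=
  forall z, S z -> constant_coefficients_at z.

Definition compatible S : Prop :=
  forall z, S z -> exists c a, [/\ chart_dom c z, basic_form c a
    & exists x0 : 'rV[R]_p, forall w, S w -> chart_dom c w -> xcoord c w = x0].

Definition admissible_transversal (I : finType) (T : I -> set M) : Prop :=
  (forall i, T i !=set0 /\ connected (T i)) /\
  exists T' : I -> set M, forall i,
    [/\ transversal F (T' i),
        T i `<=` T' i,
        compact (closure (T i) `&` T' i),
        compatible (T' i)
      & exists c a, basic_form c a /\ T' i `<=` chart_dom c].

End BasicOperators.

(* Main.v *)
Require Import Defs.
From HB Require Import structures.
From mathcomp Require Import all_boot all_order all_algebra.
From mathcomp Require Import all_classical all_reals all_analysis.
From mathcomp Require Import complex.
From mathcomp Require Import ring lra.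
From mathcomp Require polyrcf.

(** The principal symbol of [P] at a point is intrinsic: if [f] vanishes at [z], then
  [P (f ^ m) z = m! sigma(P)(df)]. The positive function [N = |sigma(P)|^2] on the
  conormal space determines a scalar product there, namely the one of maximal
  determinant among those with [q(xi)^m <= N(xi)] (the Loewner ellipsoid of
  [{N <= 1}]); uniqueness makes it equivariant under linear changes of coordinates.
  The dual scalar products form a metric on the normal bundle, which is holonomy
  invariant because in foliated charts everything depends on [y] only. It is constant
  in a chart where [P] has constant coefficients, hence smooth near the transversal.
  As its germ is the same function of [y] all along a plaque, smoothness propagates
  along the leaves, and every leaf meets the transversal. *)

Set Implicit Arguments.
Unset Strict Implicit.
Unset Printing Implicit Defensive.

Import Order.TTheory GRing.Theory Num.Theory.
Import numFieldNormedType.Exports.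

Local Open Scope classical_set_scope.
Local Open Scope ring_scope.

(** * Smooth functions on open sets of R^n *)

Section Calculus.
Context {R : realType}.

(** The maximal determinant problem does not by itself make its solution depend smoothly on the
    point, so smoothness of the metric is never derived from smoothness of the symbol. It is treated
    as a property of points: it holds where the coefficients are constant, and equality of germs
    carries it further. [P] acts only on functions defined on all of [M], so comparing its symbols
    in two charts requires globally defined functions with a prescribed differential at one point;
    hence the flat and bump functions. The symbol is complex valued; its squared modulus is a real
    polynomial on covectors, homogeneous of degree 2m and positive away from 0, hence comparable
    with the m-th power of a quadratic form. Uniqueness of the ellipsoid comes from adding two
    first-order optimality conditions. *)

Lemma cvg_sumR (T : Type) (F : set_system T) {FF : Filter F} (I : Type) (r : seq I)
    (f : I -> T -> R) (a : I -> R) :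
  (forall i, f i x @[x --> F] --> a i) ->
  \sum_(i <- r) f i x @[x --> F] --> \sum_(i <- r) a i.
Proof.
move=> fa; elim: r => [|i r IHr].
  rewrite big_nil; under eq_cvg do rewrite big_nil.
  exact: cvg_cst.
rewrite big_cons; under eq_cvg do rewrite big_cons.
exact: cvgD.
Qed.

Lemma is_derive_line n (f : 'rV[R]_n -> R) (y v : 'rV[R]_n) (c s : R) :
  derivable f (y + (s * c) *: v) v ->
  is_derive s 1 (fun t : R => f (y + (t * c) *: v))
    (c * 'D_v f (y + (s * c) *: v)).
Proof.
move=> df; set a := y + _.
have dphi : derivable (fun h : R => f (h *: v + a)) 0 1.
  exact: (derivable1P f a v).1 df.
have daff : is_derive s 1 (fun t : R => (t - s) * c) c.
  rewrite [X in is_derive _ _ X _](_ : _ = c *: ((id : R -> R) - cst s)).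
    by apply: is_derive_eq; rewrite subr0 -[_ *: _]/(_ * _) mulr1.
  by apply/funext => t; rewrite /= mulrC.
have E : (fun t : R => f (y + (t * c) *: v)) =
  (fun h : R => f (h *: v + a)) \o (fun t : R => (t - s) * c).
  apply/funext => t /=; congr f.
  by rewrite /a addrCA -scalerDl mulrBl subrK.
have D0 : ((s - s) * c) = 0 by rewrite subrr mul0r.
rewrite E mulrC.
have dg : is_derive ((s - s) * c) 1 (fun h : R => f (h *: v + a)) ('D_v f a).
  rewrite D0; split => //.
  rewrite /derive; set g1 := fun h => h^-1 *: _; set g2 := fun h => h^-1 *: _.
  suff -> : g1 = g2 by [].
  by rewrite funeqE /g1 /g2 => h /=; rewrite addr0 scale0r add0r [_%:A]mulr1.
exact: is_derive1_comp.
Qed.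

Lemma linear_approx_differentiable (V W : normedModType R) (f : V -> W)
    (df : {linear V -> W}) (x : V) : continuous df ->
  (forall e : R, 0 < e -> \forall h \near 0, `|f (h + x) - (f x + df h)| <= e * `|h|) ->
  differentiable f x.
Proof.
move=> cdf fdf.
have fE : f \o shift x = cst (f x) + df +o_ 0 id by apply/eqaddoP.
by apply/diff_locallyP; rewrite (diff_unique cdf fE).
Qed.

Lemma row_norm_le n (x : 'rV[R]_n) (e : R) : 0 <= e ->
  (`|x| <= e) <-> (forall i, `|x 0 i| <= e).
Proof.
move=> e0; split=> [xe i|xe].
  apply: le_trans xe; rewrite [leRHS]/Num.Def.normr/= mx_normrE.
  exact: (le_bigmax _ (fun ij => `|x ij.1 ij.2|) (0, i)).
rewrite [leLHS]/Num.Def.normr/= mx_normrE bigmax_le//= => -[i j] _ /=.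
by rewrite ord1.
Qed.

Lemma coord_le_norm n (x : 'rV[R]_n) i : `|x 0 i| <= `|x|.
Proof. by move: i; apply/row_norm_le. Qed.

(** The length [c] is kept apart from the direction, so that for a basis vector [v] the derivative
    on the right is a partial derivative; [c = 0] is allowed. *)
Lemma mvt_line n (f : 'rV[R]_n -> R) (y v : 'rV[R]_n) (c : R) :
  (forall s : R, 0 <= s <= 1 -> derivable f (y + (s * c) *: v) v) ->
  exists2 s : R, 0 <= s <= 1 & f (y + c *: v) - f y = c * 'D_v f (y + (s * c) *: v).
Proof.
move=> df.
have D (s : R) : 0 <= s <= 1 -> is_derive s 1 (fun t : R => f (y + (t * c) *: v))
    (c * 'D_v f (y + (s * c) *: v)) by move=> /df; exact: is_derive_line.
have [||s] := @MVT _ (fun t : R => f (y + (t * c) *: v))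
   (fun s => c * 'D_v f (y + (s * c) *: v)) 0 1 ltr01.
- by move=> x; rewrite in_itv /= => /andP[/ltW a /ltW b]; apply: D; rewrite a.
- apply: derivable_within_continuous => x; rewrite in_itv /= => /D[]//.
rewrite in_itv /= => /andP[/ltW a /ltW b] E; exists s; first by rewrite a.
by move: E; rewrite mul1r mul0r scale0r addr0 subr0 mulr1.
Qed.

Lemma continuous_partials_differentiable n (f : 'rV[R]_n -> R) (x : 'rV[R]_n) :
  (\forall y \near x, forall i, derivable f y (delta_mx 0 i)) ->
  (forall i, {for x, continuous (partial i f)}) -> differentiable f x.
Proof.
move=> df cf.
pose L (h : 'rV[R]_n) : R := \sum_i h 0 i * partial i f x.
have Llin : linear L.
  move=> a u v; rewrite /L scaler_sumr -big_split; apply: eq_bigr => i _ /=.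
  by rewrite !mxE mulrDl -[_ *: (_ * _)]/(_ * (_ * _)) mulrA.
pose LM := GRing.isLinear.Build _ _ _ _ _ Llin.
pose LL : {linear 'rV[R]_n -> R} := HB.pack L LM.
have Lc : continuous LL.
  rewrite -[X in continuous X]/L => u; apply: (@cvg_sumR _ (nbhs u)) => i.
  apply: cvgM; [exact: coord_continuous|exact: cvg_cst].
apply: (linear_approx_differentiable Lc) => _/posnumP[e].
(* Dividing by [n.+1] is harmless for [n = 0], and the [n] errors still add up to at most [e] times
   the norm of [h]. *)
have e'0 : 0 < e%:num / n.+1%:R by rewrite divr_gt0.
have : \forall y \near x, forall i, derivable f y (delta_mx 0 i) /\
    `|partial i f x - partial i f y| < e%:num / n.+1%:R.
  near=> y => i; split; first by move: i; near: y.
  move: i; near: y; apply: filter_forall => i.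
  by have /cvgrPdist_lt /(_ _ e'0) := cf i.
move=> /nbhs_ballP[r /= r0 rP].
near=> h.
have hr : `|h| < r.
  near: h; apply/nbhs_ballP; exists r => //= h.
  by rewrite -ball_normE /ball_ /= sub0r normrN.
(* [T k] keeps the first [k] coordinates of [h], so the path from [x] to [x + h] changes one
   coordinate at a time. *)
pose T k : 'rV[R]_n := \row_j (if (j < k)%N then h 0 j else 0).
have TS (k : 'I_n) : T k.+1 = T k + h 0 k *: delta_mx 0 k.
  apply/rowP => j; rewrite !mxE eqxx /=.
  rewrite ltnS leq_eqVlt; case: (eqVneq j k) => [->|jk] /=.
    by rewrite ltnn mulr1 add0r eqxx.
  rewrite -[(j == k :> nat)]/(j == k) (negbTE jk) mulr0 addr0 /=.
  by [].
(* In the sup norm, truncating [h] or shrinking one coordinate does not increase its norm, so the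
   whole path stays in the ball. *)
have Tr k (s : R) (j : 'I_n) : (k <= j)%N -> 0 <= s <= 1 ->
    ball x r ((x + T k) + (s * h 0 j) *: delta_mx 0 j).
  move=> kj /andP[s0 s1]; rewrite -ball_normE /ball_ /= -addrA opprD addNKr normrN.
  apply: le_lt_trans hr; apply/row_norm_le => // i; rewrite !mxE eqxx /=.
  case: (eqVneq i j) => [->|ij] /=.
    rewrite ltnNge kj /= add0r mulr1 normrM (ger0_norm s0).
    by apply: le_trans (coord_le_norm h j); rewrite ler_piMl.
  rewrite mulr0 addr0; case: ifP => _; first exact: coord_le_norm.
  by rewrite normr0.
have step (k : 'I_n) : exists2 d, `|d| <= e%:num / n.+1%:R &
    f (x + T k.+1) - f (x + T k) = h 0 k * (partial k f x + d).
  have [|s s01 sE] := @mvt_line _ f (x + T k) (delta_mx 0 k) (h 0 k).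
    by move=> s s01; have [] := rP _ (Tr _ _ _ (leqnn k) s01) k.
  exists (partial k f (x + T k + (s * h 0 k) *: delta_mx 0 k) - partial k f x).
    by rewrite distrC ltW //; have [] := rP _ (Tr _ _ _ (leqnn k) s01) k.
  by rewrite addrCA subrr addr0 TS addrA sE.
have [d dle dE] : exists2 d : 'I_n -> R, forall k, `|d k| <= e%:num / n.+1%:R &
   forall k : 'I_n, f (x + T k.+1) - f (x + T k) = h 0 k * (partial k f x + d k).
  exists (fun k => s2val (cid2 (step k))) => k; first exact: (s2valP (cid2 (step k))).
  exact: (s2valP' (cid2 (step k))).
have -> : f (h + x) = f x + \sum_(k < n) (f (x + T k.+1) - f (x + T k)).
  rewrite -(big_mkord xpredT (fun k => f (x + T k.+1) - f (x + T k))) telescope_sumr//.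
  rewrite [x + T 0](_ : _ = x); last first.
    by apply/rowP => j; rewrite !mxE ltn0 addr0.
  rewrite addrCA subrr addr0 addrC; congr (f (_ + _)).
  by apply/rowP => j; rewrite !mxE ltn_ord.
rewrite opprD addrACA subrr add0r /L -sumrB.
apply: le_trans (ler_norm_sum _ _ _) _.
apply: (@le_trans _ _ (\sum_(i < n) `|h| * (e%:num / n.+1%:R))).
  apply: ler_sum => k _; rewrite dE -mulrBr addrAC subrr add0r normrM.
  by apply: ler_pM => //; exact: coord_le_norm.
rewrite sumr_const card_ord -[leLHS]mulr_natr.
rewrite -mulrA mulrC ler_wpM2r // -mulrA ler_piMr //.
rewrite mulrC ler_pdivrMr ?ltr0n // mul1r ler_nat.
exact: leqnSn.
Unshelve. all: by end_near. Qed.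

Lemma smooth_on_sub n (D E : set 'rV[R]_n) f : E `<=` D -> smooth_on D f -> smooth_on E f.
Proof. by move=> ED sf l x /ED; exact: sf. Qed.

Lemma smooth_partial n (D : set 'rV[R]_n) f i : smooth_on D f -> smooth_on D (partial i f).
Proof. by move=> sf l x Dx; have := sf (rcons l i) x Dx; rewrite foldr_rcons. Qed.

Lemma open_near n (D : set 'rV[R]_n) (x : 'rV[R]_n) (P : 'rV[R]_n -> Prop) :
  open D -> D x -> (forall y, D y -> P y) -> \forall y \near x, P y.
Proof. by move=> oD Dx DP; apply: filterS DP _; exact: open_nbhs_nbhs. Qed.

Lemma foldr_partial_eq n (D : set 'rV[R]_n) (f g : 'rV[R]_n -> R) l : open D ->
  (forall x, D x -> f x = g x) ->
  forall x, D x -> foldr partial f l x = foldr partial g l x.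
Proof.
move=> oD fg; elim: l => [|i l IHl] x Dx /=; first exact: fg.
by rewrite /partial; apply: near_eq_derive; exact: open_near Dx _.
Qed.

(** Coinduction: [smooth_on] is the largest class of differentiable functions stable under partial
    derivatives, so every stable class lies in it. Agreement on [D] is enough because [D] is
    open. *)
Lemma smooth_diff_coind n (D : set 'rV[R]_n) (S : set ('rV[R]_n -> R)) : open D ->
  (forall f, S f -> (forall x, D x -> differentiable f x) /\
     forall i, exists2 g, S g & forall x, D x -> partial i f x = g x) ->
  forall f, S f -> smooth_on D f.
Proof.
move=> oD SP f Sf l.
have [g Sg fg] : exists2 g, S g & forall x, D x -> foldr partial f l x = g x.
  elim: l => [|i l [g Sg fg]]; first by exists f.
  have [_ /(_ i)[h Sh gh]] := SP _ Sg; exists h => // x Dx /=.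
  rewrite -gh // /partial; apply: near_eq_derive; exact: open_near Dx _.
move=> x Dx; have [/(_ x Dx) dg _] := SP _ Sg.
have gf : {near x, g =1 foldr partial f l}.
  by apply: open_near Dx _ => // y Dy; rewrite fg.
split.
  apply: (cvg_trans (near_eq_cvg gf)).
  by rewrite fg //; exact: (differentiable_continuous dg).
by move=> i; apply: near_eq_derivable gf _; exact: diff_derivable.
Qed.

Lemma smooth_differentiable n (D : set 'rV[R]_n) f x :
  open D -> smooth_on D f -> D x -> differentiable f x.
Proof.
move=> oD sf Dx; apply: continuous_partials_differentiable.
  by apply: open_near Dx _ => // y Dy i; have [_] := sf [::] y Dy; exact.
by move=> i; have [] := sf [:: i] x Dx.
Qed.

Inductive ring_closure n (S : set ('rV[R]_n -> R)) : ('rV[R]_n -> R) -> Prop :=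
| RingBase f : S f -> ring_closure S f
| RingAdd f g : ring_closure S f -> ring_closure S g -> ring_closure S (fun x => f x + g x)
| RingMul f g : ring_closure S f -> ring_closure S g -> ring_closure S (fun x => f x * g x).

Lemma partialD n i (f g : 'rV[R]_n -> R) x : differentiable f x -> differentiable g x ->
  partial i (fun x => f x + g x) x = partial i f x + partial i g x.
Proof. by move=> df dg; rewrite /partial deriveD //; exact: diff_derivable. Qed.

Lemma partialM n i (f g : 'rV[R]_n -> R) x : differentiable f x -> differentiable g x ->
  partial i (fun x => f x * g x) x = f x * partial i g x + g x * partial i f x.
Proof. by move=> df dg; rewrite /partial deriveM //; exact: diff_derivable. Qed.

(** Only generators have to be differentiated: by the Leibniz rule the ring they generate is then
    stable under partial derivatives, and coinduction applies to that ring. *)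
Lemma smooth_ring_closure n (D : set 'rV[R]_n) (S : set ('rV[R]_n -> R)) : open D ->
  (forall f, S f -> (forall x, D x -> differentiable f x) /\
     forall i, exists2 g, ring_closure S g & forall x, D x -> partial i f x = g x) ->
  forall f, ring_closure S f -> smooth_on D f.
Proof.
move=> oD SP; apply: smooth_diff_coind => // f; elim=> {f} [f /SP //|f g|f g].
- move=> Sf [df pf] Sg [dg pg]; split=> [x Dx|i].
    by apply: differentiableD; [exact: df|exact: dg].
  have [f' Sf' ff'] := pf i; have [g' Sg' gg'] := pg i.
  exists (fun x => f' x + g' x) => [|x Dx]; first exact: RingAdd.
  by rewrite partialD ?ff' ?gg' //; [exact: df|exact: dg].
- move=> Sf [df pf] Sg [dg pg]; split=> [x Dx|i].
    by apply: differentiableM; [exact: df|exact: dg].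
  have [f' Sf' ff'] := pf i; have [g' Sg' gg'] := pg i.
  exists (fun x => f x * g' x + g x * f' x) => [|x Dx].
    by apply: RingAdd; apply: RingMul.
  by rewrite partialM ?ff' ?gg' //; [exact: df|exact: dg].
Qed.

Lemma ring_closure_smooth n (D : set 'rV[R]_n) f : open D ->
  ring_closure (smooth_on D) f -> smooth_on D f.
Proof.
move=> oD; apply: smooth_ring_closure => // {}f sf; split=> [x Dx|i].
  exact: smooth_differentiable Dx.
by exists (partial i f) => //; apply: RingBase; exact: smooth_partial.
Qed.

Lemma smoothD n (D : set 'rV[R]_n) f g : open D -> smooth_on D f -> smooth_on D g ->
  smooth_on D (fun x => f x + g x).
Proof.
by move=> oD sf sg; apply: ring_closure_smooth => //; apply: RingAdd; exact: RingBase.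
Qed.

Lemma smoothM n (D : set 'rV[R]_n) f g : open D -> smooth_on D f -> smooth_on D g ->
  smooth_on D (fun x => f x * g x).
Proof.
by move=> oD sf sg; apply: ring_closure_smooth => //; apply: RingMul; exact: RingBase.
Qed.

Lemma smooth_cst n (D : set 'rV[R]_n) (a : R) : open D -> smooth_on D (fun=> a).
Proof.
move=> oD; apply: (@smooth_diff_coind _ _ [set f | exists a, f = fun=> a]) => //.
  move=> f [b ->]; split=> [x _|i]; first exact: differentiable_cst.
  exists (fun=> 0) => [|x _]; first by exists 0.
  by rewrite /partial derive_cst.
by exists a.
Qed.

Lemma smoothX n (D : set 'rV[R]_n) f k : open D -> smooth_on D f ->
  smooth_on D (fun x => f x ^+ k).
Proof.
move=> oD sf; elim: k => [|k IHk].
  rewrite (_ : (fun x => _) = fun=> 1); first exact: smooth_cst.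
  by apply/funext => x; rewrite expr0.
rewrite (_ : (fun x => _) = fun x => f x * f x ^+ k); first exact: smoothM.
by apply/funext => x; rewrite exprS.
Qed.

Lemma smooth_sum n (D : set 'rV[R]_n) (I : Type) (r : seq I) (f : I -> 'rV[R]_n -> R) :
  open D -> (forall i, smooth_on D (f i)) -> smooth_on D (fun x => \sum_(i <- r) f i x).
Proof.
move=> oD sf; elim: r => [|i r IHr].
  rewrite (_ : (fun x => _) = fun=> 0); first exact: smooth_cst.
  by apply/funext => x; rewrite big_nil.
rewrite (_ : (fun x => _) = fun x => f i x + \sum_(i <- r) f i x); first exact: smoothD.
by apply/funext => x; rewrite big_cons.
Qed.

Lemma smooth_on_local n (D : set 'rV[R]_n) f :
  (forall x, D x -> exists (U : set 'rV[R]_n) g,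
     [/\ open U, U x, smooth_on U g & forall y, U y -> f y = g y]) ->
  smooth_on D f.
Proof.
move=> loc l x Dx; have [U [g [oU Ux sg fg]]] := loc x Dx.
have [cg dg] := sg l x Ux.
have gf : {near x, foldr partial g l =1 foldr partial f l}.
  apply: open_near Ux _ => // y Uy; apply: (foldr_partial_eq _ oU) => // z Uz.
  by rewrite fg.
split.
  apply: (cvg_trans (near_eq_cvg gf)).
  rewrite (@foldr_partial_eq _ U f g l) //; exact: cg.
by move=> i; apply: near_eq_derivable gf _; exact: dg.
Qed.

Lemma derive_sum_partial n (u : 'rV[R]_n -> R) (y w : 'rV[R]_n) : differentiable u y ->
  'D_w u y = \sum_j w 0 j * partial j u y.
Proof.
move=> du; rewrite deriveE // [in LHS](row_sum_delta w) linear_sum.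
by apply: eq_bigr => j _; rewrite linearZ /= /partial deriveE.
Qed.

Lemma differentiable_row m n (phi : 'rV[R]_n -> 'rV[R]_m) x :
  (forall j, differentiable (fun y => phi y 0 j) x) -> differentiable phi x.
Proof.
move=> dphi.
rewrite (_ : phi = \sum_(j < m) (fun y => phi y 0 j *: (delta_mx 0 j : 'rV[R]_m))).
  by apply: differentiable_sum => j; exact: differentiableZl.
by apply/funext => y; rewrite fct_sumE [LHS]row_sum_delta.
Qed.

Lemma chain_rule m n (phi : 'rV[R]_n -> 'rV[R]_m) (u : 'rV[R]_m -> R) x v :
  (forall j, differentiable (fun y => phi y 0 j) x) -> differentiable u (phi x) ->
  'D_v (fun y => u (phi y)) x =
    \sum_j partial j u (phi x) * 'D_v (fun y => phi y 0 j) x.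
Proof.
move=> dphi du; have dph := differentiable_row dphi.
rewrite deriveE; last exact: (differentiable_comp dph du).
rewrite diff_comp //= -deriveE // -deriveE // derive_sum_partial //.
apply: eq_bigr => j _; rewrite mulrC derive_mx ?mxE //.
exact: diff_derivable.
Qed.

Lemma smooth_comp m n (D : set 'rV[R]_n) (E : set 'rV[R]_m)
    (phi : 'rV[R]_n -> 'rV[R]_m) (u : 'rV[R]_m -> R) :
  open D -> open E -> (forall x, D x -> E (phi x)) ->
  (forall j, smooth_on D (fun x => phi x 0 j)) -> smooth_on E u ->
  smooth_on D (fun x => u (phi x)).
Proof.
move=> oD oE DE sphi su.
have dphi x j : D x -> differentiable (fun x => phi x 0 j) x.
  exact: smooth_differentiable.
(* By the chain rule, a partial derivative of a pullback is a sum of products of pullbacks and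
   smooth functions: it leaves [S] but stays in the ring generated by [S]. *)
pose S := smooth_on D `|` [set f | exists2 w, smooth_on E w & f = fun x => w (phi x)].
apply: (@smooth_ring_closure _ _ S) => //; last by apply: RingBase; right; exists u.
move=> f [sf|[w sw ->]]; split=> [x Dx|i].
- exact: smooth_differentiable Dx.
- by exists (partial i f) => //; apply: RingBase; left; exact: smooth_partial.
- apply: (@differentiable_comp _ _ _ _ phi w).
    by apply: differentiable_row => j; exact: dphi.
  by apply: (smooth_differentiable oE) => //; exact: DE.
- exists (fun x => \sum_j partial j w (phi x) * partial i (fun x => phi x 0 j) x).
    elim: (index_enum _) => [|j r IHr].
      rewrite (_ : (fun x => _) = fun=> 0).
        by apply: RingBase; left; exact: smooth_cst.
      by apply/funext => x; rewrite big_nil.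
    rewrite (_ : (fun x => _) = fun x => partial j w (phi x) *
      partial i (fun x => phi x 0 j) x + \sum_(j <- r) partial j w (phi x) *
      partial i (fun x => phi x 0 j) x); last by apply/funext => x; rewrite big_cons.
    apply: RingAdd => //; apply: RingMul; apply: RingBase; last first.
      by left; exact: smooth_partial.
    by right; exists (partial j w); [exact: smooth_partial|].
  move=> x Dx; apply: chain_rule => [j|]; first exact: dphi.
  by apply: (smooth_differentiable oE) => //; exact: DE.
Qed.

Lemma partial_eq n (D : set 'rV[R]_n) (f g : 'rV[R]_n -> R) i x : open D -> D x ->
  (forall y, D y -> f y = g y) -> partial i f x = partial i g x.
Proof. by move=> oD Dx fg; exact: (foldr_partial_eq [:: i] oD fg). Qed.

(** * Composition with functions of one variable, and flat functions *)

Lemma partial_comp1 n (r : R -> R) (g : 'rV[R]_n -> R) i x dr :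
  is_derive (g x) 1 r dr -> differentiable g x ->
  partial i (fun y => r (g y)) x = dr * partial i g x.
Proof.
move=> [/derivable1_diffP rd <-] dg; rewrite /partial deriveE; last first.
  exact: (differentiable_comp dg rd).
have -> : 'd (fun y => r (g y)) x (delta_mx 0 i) = 'd r (g x) ('d g x (delta_mx 0 i)).
  by rewrite -[LHS]/('d (r \o g) x _) diff_comp.
rewrite -(deriveE _ dg) mulrC.
rewrite [in RHS](deriveE _ rd).
by rewrite -[X in 'd r (g x) X = _]mulr1 -[X in 'd r (g x) X = _]/(_ *: (1 : R)) linearZ.
Qed.

(** The recurrence is the one satisfied by s^-k exp(-1/s). Nothing else is assumed on the [r k]:
    their pullbacks by [g] and the smooth functions generate a ring stable under partial
    derivatives. *)
Lemma smooth_comp_tower n (D : set 'rV[R]_n) (g : 'rV[R]_n -> R) (r : nat -> R -> R)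
    (a b : nat -> R) :
  open D -> smooth_on D g ->
  (forall k (s : R), is_derive s 1 (r k) (a k * r k.+1 s + b k * r k.+2 s)) ->
  forall k, smooth_on D (fun x => r k (g x)).
Proof.
move=> oD sg dr k.
pose S := smooth_on D `|` [set f | exists k, f = fun x => r k (g x)].
apply: (@smooth_ring_closure _ _ S) => //; last by apply: RingBase; right; exists k.
move=> f [sf|[j ->]]; split=> [x Dx|i].
- exact: smooth_differentiable Dx.
- by exists (partial i f) => //; apply: RingBase; left; exact: smooth_partial.
- apply: (@differentiable_comp _ _ _ _ g (r j)); first exact: smooth_differentiable Dx.
  by apply/derivable1_diffP; case: (dr j (g x)).
- exists (fun x => (a j * r j.+1 (g x) + b j * r j.+2 (g x)) * partial i g x).
    apply: RingMul; last by apply: RingBase; left; exact: smooth_partial.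
    have rc c l : ring_closure S (fun x => c * r l (g x)).
      apply: RingMul; apply: RingBase; last by right; exists l.
      by left; exact: smooth_cst.
    exact: RingAdd.
  by move=> x Dx; apply: partial_comp1 => //; exact: smooth_differentiable Dx.
Qed.

(** Differentiating exp(-1/s) produces negative powers of [s], hence a family indexed by [k], whose
    linear span is stable under differentiation. *)
Definition flat (k : nat) (s : R) : R := if 0 < s then s ^- k * expR (- s^-1) else 0.

Lemma flat_gt0 k s : 0 < s -> 0 < flat k s.
Proof. by move=> s0; rewrite /flat s0 mulr_gt0 ?expR_gt0 // invr_gt0 exprn_gt0. Qed.

(** From exp x >= 1 + x^(k+1) / (k+1)! at x = 1/s. The exponential beats [s ^- k] with one factor
    [s] to spare, which gives the derivative at 0. *)
Lemma flat_le k s : `|flat k s| <= (k.+1)`!%:R * `|s|.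
Proof.
rewrite /flat; case: ifPn => [s0|_]; last by rewrite normr0 mulr_ge0.
rewrite !ger0_norm ?(ltW s0) //; last by rewrite mulr_ge0 ?expR_ge0 // invr_ge0 exprn_ge0 ?ltW.
rewrite expRN ler_pdivrMr ?expR_gt0 //.
have := @expR_ge1Dxn R s^-1 k; rewrite invr_ge0 (ltW s0) => /(_ isT) h.
apply: (@le_trans _ _ ((k.+1)`!%:R * s * (s^-1 ^+ k.+1 / (k.+1)`!%:R))); last first.
  rewrite ler_wpM2l ?mulr_ge0 ?(ltW s0) //; apply: le_trans h.
  by rewrite lerDr.
rewrite exprS exprVn le_eqVlt; apply/orP; left; apply/eqP.
by field; rewrite expf_neq0 ?gt_eqF //= pnatr_eq0 -lt0n fact_gt0.
Qed.

Lemma flat_derive k (s : R) : is_derive s 1 (flat k) (- k%:R * flat k.+1 s + 1 * flat k.+2 s).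
Proof.
have [s0|s0|->] := ltgtP s 0.
- have E : \forall x \near s, (cst 0 : R -> R) x = flat k x.
    near=> x; rewrite /flat ltNge /cst.
    suff /ltW -> : x < 0 by [].
    by near: x; exact: lt_nbhsl.
  apply: near_eq_is_derive E _; rewrite /flat (ltNge 0 s) (ltW s0) /= !mulr0 addr0.
  exact: is_derive_cst.
- pose phi (y : R) : R := y ^+ k * expR (- y).
  have E : \forall x \near s, (phi \o (fun x : R => x^-1)) x = flat k x.
    near=> x; rewrite /flat /= /phi exprVn.
    suff -> : 0 < x by [].
    by near: x; exact: lt_nbhsr.
  apply: near_eq_is_derive E _; rewrite /flat s0.
  have sn0 : s != 0 by rewrite gt_eqF.
  have dV : is_derive s 1 (fun x : R => x^-1) (- s ^- 2).
    split; first exact/derivable1_diffP/differentiable_Rinv.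
    by rewrite deriveE ?diff_Rinv //; [rewrite -[_ *: _]/(_ * _) mulr1|exact: differentiable_Rinv].
  have dX : is_derive s^-1 1 (fun y : R => y ^+ k) (k%:R * s^-1 ^+ k.-1).
    split; first exact: exprn_derivable.
    by rewrite exp_derive -[_ *: _ *: _]/(_ * _ * _) mulr1.
  have dN : is_derive s^-1 1 (fun y : R => - y) (-1) by exact: is_deriveNid.
  have dE : is_derive s^-1 1 (fun y : R => expR (- y)) (expR (- s^-1) * -1).
    exact: is_derive1_comp.
  have dphi : is_derive s^-1 1 phi (s^-1 ^+ k *: (expR (- s^-1) * -1) +
      expR (- s^-1) *: (k%:R * s^-1 ^+ k.-1)).
    exact: is_deriveM.
  have := @is_derive1_comp R phi (fun x => x^-1) s _ _ dphi dV.
  congr (is_derive _ _ _ _); rewrite -[_ *: _]/(_ * _) -[expR _ *: _]/(_ * _).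
  (* The derivative of the power has exponent [k.-1]; the factor [k] in front makes the identity
     true for [k = 0] too. *)
  have kE (j : nat) (y : R) : j%:R * y ^+ j.-1 * y ^+ 2 = j%:R * (y * y ^+ j).
    by case: j => [|j]; rewrite ?mul0r //= [in RHS]exprS; ring.
  rewrite -!exprVn; move: (s^-1) (expR _) => y e.
  have := kE k y; rewrite !exprS expr0; move: (y ^+ k.-1) (y ^+ k) k%:R => a b c h.
  transitivity (b * (e * -1) * - (y * (y * 1)) - e * (c * a * (y * (y * 1)))); first by ring.
  by rewrite h; ring.
- rewrite {2 3}/flat ltxx !mulr0 addr0.
  have L : (fun h : R => h^-1 *: (flat k (h *: 1 + 0) - flat k 0)) @ 0^' --> (0 : R).
    apply/cvgr0Pnorm_le => e e0.
    have c0 : 0 < (k.+2)`!%:R :> R by rewrite ltr0n fact_gt0.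
    near=> h.
    (* The difference quotient of [flat k] at 0 is [flat k.+1], whose bound has the constant
       (k+2)!. *)
    have -> : h^-1 *: (flat k (h *: 1 + 0) - flat k 0) = flat k.+1 h.
      rewrite [h *: 1 + 0]addr0 -[h *: 1]/(h * 1) mulr1 {2}/flat ltxx subr0 /flat.
      case: ifP => _; last by rewrite scaler0.
      by rewrite -[_ *: _]/(_ * _) exprS invfM mulrA.
    apply: le_trans (flat_le _ _) _; rewrite mulrC -ler_pdivlMr //.
    by near: h; apply: dnbhs0_le; rewrite divr_gt0.
  split; first by apply/cvg_ex; exists 0.
  exact/cvg_lim.
Unshelve. all: by end_near. Qed.

Lemma smooth_flat n (D : set 'rV[R]_n) (g : 'rV[R]_n -> R) k : open D -> smooth_on D g ->
  smooth_on D (fun x => flat k (g x)).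
Proof. by move=> oD sg; exact: (smooth_comp_tower oD sg flat_derive). Qed.

Lemma partialX n i (f : 'rV[R]_n -> R) k x : differentiable f x ->
  partial i (fun y => f y ^+ k.+1) x = k.+1%:R * f x ^+ k * partial i f x.
Proof.
move=> df; apply: (@partial_comp1 _ (fun y => y ^+ k.+1) f i x (k.+1%:R * f x ^+ k) _ df).
split; first exact: exprn_derivable.
by rewrite exp_derive -[_ *: _ *: _]/(_ * _ * _) mulr1.
Qed.

(* Each derivative of [h ^+ m] lowers the exponent of [h] by at most one; only the
   term which loses one factor [h] per derivative survives at a zero of [h]. *)
Lemma partials_power n (D : set 'rV[R]_n) (h : 'rV[R]_n -> R) m (l : seq 'I_n) :
  open D -> smooth_on D h -> (size l <= m)%N ->
  exists2 w, smooth_on D w & forall x, D x ->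
    foldr partial (fun y => h y ^+ m) l x =
      (m ^_ (size l))%:R * h x ^+ (m - size l) * (\prod_(i <- l) partial i h x)
      + h x ^+ (m - size l).+1 * w x.
Proof.
move=> oD sh; elim: l => [|i l IHl] lm.
  exists (fun=> 0); first exact: smooth_cst.
  by move=> x _; rewrite big_nil ffactn0 subn0 mulr0 addr0 mul1r mulr1.
have {IHl}[w sw wE] := IHl (ltnW lm).
set c : R := (m ^_ (size l))%:R in wE.
set e' := (m - size (i :: l))%N; have eE : (m - size l = e'.+1)%N by rewrite /e' /= subnS prednK // subn_gt0.
pose Pi x := \prod_(i <- l) partial i h x.
have sPi : smooth_on D Pi.
  rewrite /Pi; elim: (l) => [|j r IHr].
    rewrite (_ : (fun x => _) = fun=> 1); first exact: smooth_cst.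
    by apply/funext => x; rewrite big_nil.
  rewrite (_ : (fun x => _) = fun x => partial j h x * \prod_(i <- r) partial i h x).
    exact: (smoothM oD (smooth_partial j sh) IHr).
  by apply/funext => x; rewrite big_cons.
have sc a : smooth_on D (fun=> a : R) := smooth_cst a oD.
(* The remainder collects the derivative of the product [Pi] and that of the former remainder
   [h ^+ e'.+2 * w], with [h ^+ e'.+1] factored out. *)
exists (fun x => c * partial i Pi x + (e'.+2%:R * (partial i h x * w x) + h x * partial i w x)).
  apply: (smoothD oD (smoothM oD (sc c) (smooth_partial i sPi))).
  apply: (smoothD oD (smoothM oD (sc _) (smoothM oD (smooth_partial i sh) sw))).
  exact: (smoothM oD sh (smooth_partial i sw)).
move=> x Dx /=; rewrite (partial_eq i oD Dx wE) eE.
have dh := smooth_differentiable oD sh Dx.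
have dw := smooth_differentiable oD sw Dx.
have dPi := smooth_differentiable oD sPi Dx.
have dX k := smooth_differentiable oD (smoothX k oD sh) Dx.
have dcX := smooth_differentiable oD (smoothM oD (sc c) (smoothX e'.+1 oD sh)) Dx.
have d1 := smooth_differentiable oD (smoothM oD (smoothM oD (sc c) (smoothX e'.+1 oD sh)) sPi) Dx.
have d2 := smooth_differentiable oD (smoothM oD (smoothX e'.+2 oD sh) sw) Dx.
have dc := smooth_differentiable oD (sc c) Dx.
rewrite (partialD i d1 d2) (partialM i dcX dPi) (partialM i dc (dX _)) (partialM i (dX _) dw).
rewrite !(partialX i _ dh) [partial i (fun=> c) x]derive_cst big_cons -/(Pi x).
rewrite ffactnSr natrM -/c eE -/e' !exprS; ring.
Qed.

(** * Functions of the transverse coordinates only *)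

Lemma rsubmx_eq_rshift p q (t t' : 'rV[R]_(p + q)) j : rsubmx t = rsubmx t' ->
  t 0 (rshift p j) = t' 0 (rshift p j).
Proof. by move=> /rowP/(_ j); rewrite !mxE. Qed.

Lemma ball_segment n (x t v : 'rV[R]_n) r (s : R) : 0 <= s <= 1 ->
  ball x r t -> ball x r (t + v) -> ball x r (t + s *: v).
Proof.
rewrite -ball_normE /ball_ /= => /andP[s0 s1] xt xv.
have -> : x - (t + s *: v) = (1 - s) *: (x - t) + s *: (x - (t + v)).
  apply/rowP => i; rewrite !mxE; ring.
apply: le_lt_trans (ler_normD _ _) _; rewrite !normrZ (ger0_norm s0) ger0_norm ?subr_ge0 //.
have [s00|s00] := eqVneq s 0; first by rewrite s00 subr0 mul1r mul0r addr0.
have sp : 0 < s by rewrite lt0r s00.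
apply: (@lt_le_trans _ _ ((1 - s) * r + s * r)); last by rewrite -mulrDl subrK mul1r.
by apply: ler_ltD; [rewrite ler_wpM2l ?subr_ge0 // ltW|rewrite ltr_pM2l].
Qed.

(** The vector [t' - t] has no y component, so the mean value theorem on the segment gives equality.
    Convexity of the ball matters: in a general open set the slices at constant y may be
    disconnected. *)
Lemma partial_x_zero p q (u : 'rV[R]_(p + q) -> R) x r :
  (forall t, ball x r t -> differentiable u t) ->
  (forall t, ball x r t -> forall i : 'I_p, partial (lshift q i) u t = 0) ->
  forall t t', ball x r t -> ball x r t' -> rsubmx t = rsubmx t' -> u t = u t'.
Proof.
move=> du u0 t t' xt xt' tt'.
have tv s : 0 <= s <= 1 -> ball x r (t + (s * 1) *: (t' - t)).
  by move=> s01; rewrite mulr1; apply: ball_segment => //; rewrite addrCA subrr addr0.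
have [s s01|s s01] := @mvt_line _ u t (t' - t) 1.
  exact/diff_derivable/du/tv.
rewrite scale1r addrCA subrr addr0 mul1r derive_sum_partial; last exact/du/tv.
move=> E; apply/esym/eqP; rewrite -subr_eq0 E; apply/eqP; rewrite big1 // => i _.
case: (split_ordP i) => j ->; first by rewrite u0 ?mulr0 //; exact: tv.
by rewrite !mxE (rsubmx_eq_rshift j tt') subrr mul0r.
Qed.

Lemma partial_lshift0 p q (u : 'rV[R]_(p + q) -> R) x r (i : 'I_p) : 0 < r ->
  (forall t t', ball x r t -> ball x r t' -> rsubmx t = rsubmx t' -> u t = u t') ->
  partial (lshift q i) u x = 0.
Proof.
move=> r0 uy; rewrite /partial /derive.
have E : \forall h \near (0 : R)^', h^-1 *: (u (h *: delta_mx 0 (lshift q i) + x) - u x) = 0.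
  near=> h; rewrite (uy (h *: delta_mx 0 (lshift q i) + x) x) ?subrr ?scaler0 //.
  - rewrite -ball_normE /ball_ /= opprD addrCA subrr addr0 normrN normrZ.
    apply: le_lt_trans (_ : `|h| * 1 < r).
      rewrite ler_wpM2l //; apply/row_norm_le => // k; rewrite mxE.
      by case: (_ && _); rewrite ?normr1 ?normr0.
    rewrite mulr1; near: h; exact: dnbhs0_lt.
  - exact: ballxx.
  - by apply/rowP => j; rewrite !mxE eqxx eq_rlshift /= mulr0 add0r.
by apply/cvg_lim => //; exact: cvg_near_cst.
Unshelve. all: by end_near. Qed.

(** Near [t'] the function [u] agrees with its translate by [t - t'], a vector along the x
    directions. *)
Lemma partial_same_y p q (u : 'rV[R]_(p + q) -> R) x r k :
  (forall t t', ball x r t -> ball x r t' -> rsubmx t = rsubmx t' -> u t = u t') ->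
  0 < r -> forall t t', ball x r t -> ball x r t' -> rsubmx t = rsubmx t' ->
    partial k u t = partial k u t'.
Proof.
move=> uy r0 t t' xt xt' tt'; rewrite /partial.
pose w s := u (s + (t - t')).
have -> : 'D_(delta_mx 0 k) u t = 'D_(delta_mx 0 k) w t'.
  rewrite /derive /w; set g1 := fun h => _; set g2 := fun h => _.
  suff -> : g1 = g2 by [].
  apply/funext => h; rewrite /g1 /g2 /= -addrA.
  have -> : t' + (t - t') = t by rewrite addrCA subrr addr0.
  by [].
have E : t' + (t - t') = t by rewrite addrCA subrr addr0.
have ob : open (ball x r) by exact: ball_open.
apply: near_eq_derive.
have n1 : \forall s \near t', ball x r s by exact: open_nbhs_nbhs.
have n2 : \forall s \near t', ball x r (s + (t - t')).
  have /nbhs_ballP[e /= e0 ep] : nbhs t (ball x r) by exact: open_nbhs_nbhs.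
  apply/nbhs_ballP; exists e => //= s se; apply: ep; move: se.
  rewrite -!ball_normE /ball_ /=; congr (`|_| < _).
  by rewrite -[X in X - (s + _)]E opprD addrACA subrr addr0.
near=> s; rewrite /w; apply: uy.
- by near: s.
- by near: s.
- by rewrite linearD linearB /= tt' subrr addr0.
Unshelve. all: by end_near. Qed.

End Calculus.

Lemma smooth_on_eq (R : realType) n (D : set 'rV[R]_n) f g : open D ->
  (forall x, D x -> f x = g x) -> smooth_on D g -> smooth_on D f.
Proof. by move=> oD fg sg; apply: smooth_on_local => x Dx; exists D, g. Qed.

Lemma partial_coord (R : realType) n (i j : 'I_n) (x : 'rV[R]_n) :
  partial i (fun t : 'rV[R]_n => t 0 j) x = (i == j)%:R.
Proof.
have D : derivable (id : 'rV[R]_n -> 'rV[R]_n) x (delta_mx 0 i) by exact: derivable_id.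
have /matrixP/(_ 0 j) := derive_mx D.
by rewrite derive_id !mxE eqxx /= eq_sym /partial => <-.
Qed.

Lemma smooth_coord (R : realType) n (j : 'I_n) : smooth_on setT (fun t : 'rV[R]_n => t 0 j).
Proof.
have oT : open [set: 'rV[R]_n] by exact: openT.
pose S := [set f | (f = fun t : 'rV[R]_n => t 0 j) \/ exists a : R, f = fun=> a].
apply: (@smooth_diff_coind R n setT S oT); last by left.
move=> _ [->|[a ->]]; split=> [x _|i].
- exact: differentiable_coord.
- by exists (fun=> (i == j)%:R) => [|x _]; [right; exists (i == j)%:R|exact: partial_coord].
- exact: differentiable_cst.
- by exists (fun=> 0) => [|x _]; [right; exists 0|rewrite /partial derive_cst].
Qed.

Lemma partial_sum (R : realType) n (D : set 'rV[R]_n) (I : Type) (r : seq I)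
    (f : I -> 'rV[R]_n -> R) k x : open D -> D x -> (forall i, smooth_on D (f i)) ->
  partial k (fun t => \sum_(i <- r) f i t) x = \sum_(i <- r) partial k (f i) x.
Proof.
move=> oD Dx sf; elim: r => [|i r IHr].
  rewrite big_nil (_ : (fun t => _) = fun=> 0) ?/partial ?derive_cst //.
  by apply/funext => t; rewrite big_nil.
rewrite big_cons -IHr -partialD; last 2 first.
- exact: (smooth_differentiable oD (sf i)).
- exact: (smooth_differentiable oD (smooth_sum r oD sf)).
by congr partial; apply/funext => t; rewrite big_cons.
Qed.

Lemma partial_affine (R : realType) n (a b : R) (j k : 'I_n) (x : 'rV[R]_n) :
  partial k (fun t : 'rV[R]_n => a * (t 0 j + b)) x = a * (k == j)%:R.
Proof.
have dc (e : R) : differentiable (fun _ : 'rV[R]_n => e) x by exact: differentiable_cst.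
have dx : differentiable (fun t : 'rV[R]_n => t 0 j) x by exact: differentiable_coord.
have dxb : differentiable (fun t : 'rV[R]_n => t 0 j + b) x by exact: differentiableD.
rewrite (partialM k (dc a) dxb) (partialD k dx (dc b)) partial_coord.
by rewrite [partial k (fun=> b) x]derive_cst [partial k (fun=> a) x]derive_cst mulr0 !addr0.
Qed.

(** * The Loewner ellipsoid *)

(** Turns the transformation law of scalar products on covectors into that of the dual ones on
    normal vectors. *)
Lemma invmx_conj (R : comUnitRingType) n (J K L A : 'M[R]_n) : K *m J = 1%:M ->
  L \in unitmx -> A = J *m L *m J^T -> invmx A = K^T *m invmx L *m K.
Proof.
move=> KJ Lu AE; have JK := mulmx1C KJ.
have AX : A *m (K^T *m invmx L *m K) = 1%:M.
  rewrite (_ : _ *m _ = J *m L *m (J^T *m K^T) *m invmx L *m K); last by rewrite AE !mulmxA.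
  by rewrite -trmx_mul KJ trmx1 mulmx1 mulmxK // JK.
have [Au _] := mulmx1_unit AX.
by rewrite -[RHS](mulKmx Au) AX mulmx1.
Qed.

Section QuadraticForms.
Context {R : realType}.

Definition qform q (A : 'M[R]_q) (x : 'rV[R]_q) : R := (x *m A *m x^T) 0 0.

Definition posdef q (A : 'M[R]_q) : Prop :=
  A^T = A /\ forall x : 'rV[R]_q, x != 0 -> 0 < qform A x.

Lemma qformE q (A : 'M[R]_q) x : qform A x = \sum_i \sum_j A i j * (x 0 i * x 0 j).
Proof.
rewrite /qform mxE exchange_big /=; apply: eq_bigr => j _.
rewrite !mxE big_distrl /=; apply: eq_bigr => i _.
by rewrite mulrAC mulrC.
Qed.

Lemma qform0 q (A : 'M[R]_q) : qform A 0 = 0.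
Proof. by rewrite /qform !mul0mx mxE. Qed.

Lemma qform_mul q r (A : 'M[R]_q) (S : 'M[R]_(r, q)) x :
  qform (S *m A *m S^T) x = qform A (x *m S).
Proof. by rewrite /qform trmx_mul !mulmxA. Qed.

Lemma mulmx_tr_ge0 q (x : 'rV[R]_q) : 0 <= (x *m x^T) 0 0.
Proof. by rewrite mxE sumr_ge0 // => i _; rewrite mxE sqr_ge0. Qed.

Lemma mulmx_tr_eq0 q (x : 'rV[R]_q) : (x *m x^T) 0 0 = 0 -> x = 0.
Proof.
move=> /eqP; rewrite mxE psumr_eq0 => [/allP x0|i _]; last by rewrite mxE sqr_ge0.
apply/rowP => i; have := x0 i (mem_index_enum i).
by rewrite !mxE mulf_eq0 orbb => /eqP.
Qed.

(** If [u = x *m A] were nonzero, a small move from [x] in the direction [- u] would make the form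
    negative, its first variation there being -2 |u|^2. *)
Lemma psd_null q (A : 'M[R]_q) x : A^T = A -> (forall y, 0 <= qform A y) ->
  qform A x = 0 -> x *m A = 0.
Proof.
move=> At A0 Ax; set u := x *m A; apply: mulmx_tr_eq0.
set s := _ 0 0; have s0 : 0 <= s by exact: mulmx_tr_ge0.
set w := qform A u; have w0 : 0 <= w by exact: A0.
have key t : 0 <= t * (t * w - 2 * s).
  have := A0 (x - t *: u).
  have cE y z : qform A (y - t *: z) = qform A y - t * (y *m A *m z^T) 0 0
      - t * ((z *m A *m y^T) 0 0 - t * qform A z).
    have mB (M N : 'M[R]_1) : (M - N) 0 0 = M 0 0 - N 0 0 by rewrite !mxE.
    have mZ (k : R) (M : 'M[R]_1) : (k *: M) 0 0 = k * M 0 0 by rewrite mxE.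
    rewrite /qform !mulmxBl -!scalemxAl [(_ - _)^T]linearB /= [(_ *: _)^T]linearZ /=.
    by rewrite !mulmxBr -!scalemxAr !(mB, mZ).
  have uAx : (u *m A *m x^T) 0 0 = s by rewrite -mulmxA /s {2}/u trmx_mul At.
  by rewrite cE Ax uAx -/u -/s -/w => h; rewrite (_ : _ * _ = 0 - t * s - t * (s - t * w)) //; ring.
apply/eqP; rewrite eq_le s0 andbT leNgt; apply/negP => sp.
(* The added 1 covers [w = 0]; with this [t] one has [t * w <= s < 2 * s]. *)
have /= := key (s / (w + 1)).
have w1 : 0 < w + 1 by lra.
rewrite pmulr_rge0; last by rewrite divr_gt0.
rewrite mulrAC -mulrA leNgt => /negP; apply.
rewrite subr_lt0 mulrC; apply: (@le_lt_trans _ _ (1 * s)); last by lra.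
by rewrite ler_wpM2r // ler_pdivrMr // mul1r; lra.
Qed.

Lemma posdef_unit q (A : 'M[R]_q) : posdef A -> A \in unitmx.
Proof.
move=> [_ A0]; rewrite unitmxE unitfE; apply/negP => /det0P[v v0 vA].
by have := A0 v v0; rewrite /qform vA mul0mx mxE ltxx.
Qed.

(** Cholesky factorization by induction on the size: clearing the first row and column leaves a
    Schur complement. *)
Lemma posdef_gram q (A : 'M[R]_q) : posdef A -> exists S : 'M[R]_q, A = S^T *m S.
Proof.
elim: q A => [A _|q IHq]; first by exists 0; apply/matrixP => -[].
rewrite -[q.+1]/(1 + q)%N => A [At A0].
pose a := A 0 0; pose b : 'rV[R]_q := ursubmx A; pose D := drsubmx A.
have AE : A = block_mx a%:M b b^T D.
  rewrite -[LHS](@submxK _ 1 q 1 q) -/b -/D; congr block_mx; last first.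
    by rewrite /b -[in RHS]At trmx_ursub trmxK.
  by apply/matrixP => i j; rewrite !ord1 !mxE /a; congr (A _ _); apply/val_inj.
have a0 : 0 < a.
  pose e : 'rV[R]_(1 + q) := delta_mx 0 0.
  have -> : a = qform A e by rewrite /qform /e -rowE trmx_delta -colE !mxE.
  apply: A0; apply/eqP => /matrixP/(_ 0 0); rewrite !mxE eqxx => /eqP.
  by rewrite oner_eq0.
have an0 : a != 0 by rewrite gt_eqF.
have [|S SE] := IHq (D - a^-1 *: (b^T *m b)).
  have Dt : D^T = D by rewrite /D -[in RHS]At trmx_drsub.
  split; first by rewrite linearB linearZ /= trmx_mul trmxK Dt.
  (* The first block of [y] minimizes the form of [A] for given [x], and the minimum is the value of
     the Schur complement at [x]. *)
  move=> x x0; pose y : 'rV[R]_(1 + q) := row_mx (- (a^-1 *: (x *m b^T))) x.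
  have y0 : y != 0.
    apply: contra x0 => /eqP y0; apply/eqP.
    by rewrite -[x](row_mxKr (- (a^-1 *: (x *m b^T)))) -/y y0 linear0.
  have := A0 y y0; congr (0 < _).
  rewrite /qform AE /y mul_row_block tr_row_mx mul_row_col.
  rewrite mulNmx -scalemxAl mul_mx_scalar scalerA mulVf // scale1r addNr mul0mx add0r.
  by rewrite mulNmx -scalemxAl mulmxBr -scalemxAr mulmxA addrC.
exists (block_mx (Num.sqrt a)%:M ((Num.sqrt a)^-1 *: b) 0 S).
have sa : Num.sqrt a != 0 by rewrite gt_eqF // sqrtr_gt0.
rewrite tr_block_mx mulmx_block AE trmx0 !mul0mx !mulmx0 !addr0 tr_scalar_mx; congr block_mx.
- by rewrite -scalar_mxM -expr2 sqr_sqrtr // ltW.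
- by rewrite mul_scalar_mx scalerA divff // scale1r.
- by rewrite linearZ /= -scalemxAl mul_mx_scalar scalerA mulVf // scale1r.
- rewrite [(_ *: b)^T]linearZ /= -scalemxAl -scalemxAr scalerA -SE -invfM -expr2 sqr_sqrtr ?(ltW a0) //.
  by rewrite addrC subrK.
Qed.

Lemma posdef_psd q (A : 'M[R]_q) : A^T = A -> (forall x, 0 <= qform A x) ->
  A \in unitmx -> posdef A.
Proof.
move=> At A0 Au; split=> // x x0; rewrite lt0r A0 andbT.
apply: contra x0 => /eqP /(psd_null At A0) xA.
by rewrite -[x](mulmxK Au) xA mul0mx.
Qed.

Lemma posdef_inv q (A : 'M[R]_q) : posdef A -> posdef (invmx A).
Proof.
move=> pA; have Au := posdef_unit pA; have [At A0] := pA.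
have It : (invmx A)^T = invmx A by rewrite trmx_inv At.
split=> // x x0.
have -> : qform (invmx A) x = qform A (x *m invmx A).
  by rewrite /qform trmx_mul It !mulmxA mulmxKV.
apply: A0; apply: contra x0 => /eqP xA.
by rewrite -[x](mulmxKV Au) xA mul0mx.
Qed.

Lemma diag_conj q r (M : 'M[R]_(r, q)) (B : 'M[R]_q) i :
  (M *m B *m M^T) i i = qform B (row i M).
Proof.
by rewrite /qform -row_mul mxE [RHS]mxE; apply: eq_bigr => j _; rewrite !mxE.
Qed.

(** Writing [A = S^T *m S] turns the trace into the sum of the values of the form [B] on the rows of
    [S *m H]. They are nonnegative, so all vanish and [S *m H = 0]. *)
Lemma trace_conj_eq0 q (A B H : 'M[R]_q) : posdef A -> posdef B -> H^T = H ->
  \tr (A *m H *m B *m H) <= 0 -> H = 0.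
Proof.
move=> pA pB Ht; have Au := posdef_unit pA; have [S AE] := posdef_gram pA.
have trE : \tr (A *m H *m B *m H) = \sum_i qform B (row i (S *m H)).
  rewrite AE -!mulmxA mxtrace_mulC !mulmxA; apply: eq_bigr => i _.
  by rewrite -diag_conj trmx_mul Ht !mulmxA.
have B0 x : 0 <= qform B x.
  by case: (eqVneq x 0) => [->|/pB.2/ltW//]; rewrite qform0.
rewrite trE => tr0.
have SH0 : S *m H = 0.
  apply/row_matrixP => i; rewrite row0; apply/eqP; apply/negP => /negP /pB.2.
  rewrite ltNge => /negP; apply.
  apply: le_trans tr0; rewrite (bigD1 i) //= lerDl sumr_ge0 // => j _; exact: B0.
by rewrite -[H](mulKmx Au) AE -mulmxA SH0 !mulmx0.
Qed.

(** A first-order statement at t = 0, proved algebraically. With s = 1/t, the hypothesis bounds the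
    characteristic polynomial of [- X] by s^q for s >= 1, and its coefficient of degree q - 1 is
    [\tr X]. *)
Lemma det_line_trace q (X : 'M[R]_q) :
  (forall t : R, 0 <= t <= 1 -> \det (1%:M + t *: X) <= 1) -> \tr X <= 0.
Proof.
move=> X1; rewrite leNgt; apply/negP => trX.
have q0 : (0 < q)%N by case: q X X1 trX => // X _; rewrite /mxtrace big_ord0 ltxx.
pose r := char_poly (- X) - 'X^q.
have rle (s : R) : 1 <= s -> r.[s] <= 0.
  move=> s1; have s0 : 0 < s by rewrite (lt_le_trans ltr01).
  rewrite /r hornerD hornerN hornerXn subr_le0.
  have -> : (char_poly (- X)).[s] = \det (s *: (1%:M + s^-1 *: X)).
    rewrite -horner_evalE -det_map_mx; congr (\det _); apply/matrixP => i j.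
    rewrite !mxE /= /horner_eval hornerD hornerN hornerMn hornerX hornerC opprK.
    by case: (i == j) => /=; rewrite ?mulr1n ?mulr0n; field; rewrite gt_eqF.
  rewrite detZ ler_piMr ?exprn_ge0 ?(ltW s0) // X1 // invr_ge0 (ltW s0) /=.
  by rewrite invf_le1.
have rc : r`_q.-1 = \tr X.
  rewrite coefB coefXn char_poly_trace // -[q in (_ == q)](prednK q0).
  by rewrite -[_ == _]/(_ == _) eqn_leq ltnn andbF subr0 linearN opprK.
have rs : (size r <= q)%N.
  apply/leq_sizeP => j; rewrite leq_eqVlt => /orP[/eqP <-|qj].
    have := char_poly_monic (- X); rewrite monicE lead_coefE size_char_poly /= => /eqP E.
    by rewrite coefB E coefXn eqxx subrr.
  by rewrite coefB nth_default ?size_char_poly // coefXn gtn_eqF // subrr.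
have sr : size r = q.
  apply/eqP; rewrite eqn_leq rs /= -(prednK q0) ltnNge; apply/negP => /leq_sizeP.
  by move=> /(_ _ (leqnn _)) E; rewrite -rc E ltxx in trX.
(* A positive trace is the leading coefficient of [r], which for large arguments is then at least
   this coefficient, against [rle]. *)
have [|y yP] := @polyrcf.poly_pinfty_gt_lc R r; first by rewrite lead_coefE sr rc.
have := rle (Num.max 1 y); rewrite le_max lexx => /(_ isT).
have := yP (Num.max 1 y); rewrite le_max lexx orbT => /(_ isT).
rewrite lead_coefE sr rc => h1 h2.
by have := lt_le_trans trX (le_trans h1 h2); rewrite ltxx.
Qed.

Definition below m q (N : 'rV[R]_q -> R) (A : 'M[R]_q) : Prop :=
  A^T = A /\ forall x, 0 <= qform A x /\ qform A x ^+ m <= N x.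

Definition loewner m q (N : 'rV[R]_q -> R) (A : 'M[R]_q) : Prop :=
  [/\ below m N A, 0 < \det A & forall B, below m N B -> \det B <= \det A].

Lemma loewner_posdef m q (N : 'rV[R]_q -> R) A : loewner m N A -> posdef A.
Proof.
move=> [[At A0] dA _]; apply: posdef_psd => // [x|]; first by case: (A0 x).
by rewrite unitmxE unitfE gt_eqF.
Qed.

Lemma qform_line q (A B : 'M[R]_q) t x :
  qform (A + t *: (B - A)) x = qform A x + t * (qform B x - qform A x).
Proof.
have mB (M P : 'M[R]_1) : (M - P) 0 0 = M 0 0 - P 0 0 by rewrite !mxE.
have mD (M P : 'M[R]_1) : (M + P) 0 0 = M 0 0 + P 0 0 by rewrite !mxE.
have mZ (k : R) (M : 'M[R]_1) : (k *: M) 0 0 = k * M 0 0 by rewrite mxE.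
rewrite /qform mulmxDr -scalemxAr mulmxBr mulmxDl -scalemxAl mulmxBl.
by rewrite mD mZ mB.
Qed.

(** An interpolated value lies between the two given ones, and the m-th power of the larger is at
    most [N x]. *)
Lemma below_line m q (N : 'rV[R]_q -> R) A B t : 0 <= t <= 1 ->
  below m N A -> below m N B -> below m N (A + t *: (B - A)).
Proof.
move=> /andP[t0 t1] [At A0] [Bt B0]; split.
  by rewrite linearD linearZ linearB /= At Bt.
move=> x; have [a0 aN] := A0 x; have [b0 bN] := B0 x; rewrite qform_line.
move: (qform A x) (qform B x) a0 aN b0 bN => a b a0 aN b0 bN.
have ab0 : 0 <= a + t * (b - a) by nra.
split=> //; have [ab|/ltW ba] := leP a b.
  by apply: le_trans bN; rewrite lerXn2r ?nnegrE //; nra.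
by apply: le_trans aN; rewrite lerXn2r ?nnegrE //; nra.
Qed.

(** First-order optimality: the segment from [A] to [B] stays admissible, so on it the determinant
    never exceeds [\det A]; factoring [A] out leads to [det_line_trace]. *)
Lemma loewner_trace m q (N : 'rV[R]_q -> R) A B : loewner m N A -> below m N B ->
  \tr (invmx A *m (B - A)) <= 0.
Proof.
move=> lA bB; have pA := loewner_posdef lA; have Au := posdef_unit pA.
have [bA dA mA] := lA; apply: det_line_trace => t t01.
have := mA _ (below_line t01 bA bB).
rewrite -[X in X + _](mulmx1 A) -[B - A in X in X -> _](mulKVmx Au) scalemxAr -mulmxDr.
by rewrite det_mulmx ger_pMr.
Qed.

(** The optimality conditions at [A] towards [B] and at [B] towards [A] add up to tr (A^-1 (B - A)
    B^-1 (B - A)) <= 0, which forces [B - A = 0]. *)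
Lemma loewner_unique m q (N : 'rV[R]_q -> R) A B : loewner m N A -> loewner m N B -> A = B.
Proof.
move=> lA lB; have pA := loewner_posdef lA; have pB := loewner_posdef lB.
have Au := posdef_unit pA; have Bu := posdef_unit pB.
have tA := loewner_trace lA (let: And3 b _ _ := lB in b).
have tB := loewner_trace lB (let: And3 b _ _ := lA in b).
apply/esym/eqP; rewrite -subr_eq0; apply/eqP.
apply: (trace_conj_eq0 (posdef_inv pA) (posdef_inv pB)).
  by rewrite linearB /= pA.1 pB.1.
have -> : invmx A *m (B - A) *m invmx B *m (B - A) =
    invmx A *m (B - A) + invmx B *m (A - B).
  rewrite -!mulmxA [invmx B *m (B - A)]mulmxBr mulVmx // mulmxBr mulmx1.
  rewrite mulmxBl mulmxBr !mulmxA mulmxV // mul1mx.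
  rewrite [invmx A *m (A - _)]mulmxBr mulVmx // -[A *m _ *m A]mulmxA mulKmx //.
  by rewrite [invmx B *m (A - _)]mulmxBr mulVmx // opprB.
by rewrite linearD /=; lra.
Qed.

(** * Existence of the Loewner ellipsoid by compactness, and its equivariance *)

Lemma qform_cvg T (F : set_system T) {FF : Filter F} q (A : T -> 'M[R]_q) (B : 'M[R]_q) x :
  (forall i j, A t i j @[t --> F] --> B i j) -> qform (A t) x @[t --> F] --> qform B x.
Proof.
move=> AB; rewrite (_ : (fun t => _) = fun t => \sum_i \sum_j A t i j * (x 0 i * x 0 j)).
  rewrite qformE; apply: cvg_sumR => i; apply: cvg_sumR => j.
  by apply: cvgM; [exact: AB|exact: cvg_cst].
by apply/funext => t; rewrite qformE.
Qed.

Lemma cvg_prodR (T : Type) (F : set_system T) {FF : Filter F} (I : Type) (r : seq I)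
    (f : I -> T -> R) (a : I -> R) :
  (forall i, f i x @[x --> F] --> a i) ->
  \prod_(i <- r) f i x @[x --> F] --> \prod_(i <- r) a i.
Proof.
move=> fa; elim: r => [|i r IHr].
  rewrite big_nil; under eq_cvg do rewrite big_nil.
  exact: cvg_cst.
rewrite big_cons; under eq_cvg do rewrite big_cons.
exact: cvgM.
Qed.

Lemma det_cvg T (F : set_system T) {FF : Filter F} q (A : T -> 'M[R]_q) (B : 'M[R]_q) :
  (forall i j, A t i j @[t --> F] --> B i j) -> \det (A t) @[t --> F] --> \det B.
Proof.
move=> AB; apply: cvg_sumR => s; apply: cvgM; first exact: cvg_cst.
by apply: cvg_prodR => i; exact: AB.
Qed.

(** A diagonal entry above 1 is at most its m-th power, hence at most [N]; this is the origin of the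
    1. Off the diagonal, nonnegativity of the form at e_i + e_j and e_i - e_j bounds the entry by
    diagonal ones. *)
Lemma below_entry m q (N : 'rV[R]_q -> R) (A : 'M[R]_q) i j : (0 < m)%N ->
  (forall x, 0 <= N x) -> below m N A ->
  `|A i j| <= \sum_k (1 + N (delta_mx 0 k)).
Proof.
move=> m0 N0 [At A0].
have dE (B : 'M[R]_q) k l : ((delta_mx 0 k : 'rV_q) *m B *m (delta_mx 0 l : 'rV_q)^T) 0 0 = B k l.
  by rewrite -rowE trmx_delta -colE !mxE.
have dA k : 0 <= A k k <= 1 + N (delta_mx 0 k).
  have := A0 (delta_mx 0 k); rewrite /qform dE => -[a0 aN]; rewrite a0 /= leNgt.
  apply/negP => a1; move: aN; rewrite leNgt => /negP; apply.
  have a1' : 1 <= A k k by apply: ltW; apply: le_lt_trans a1; rewrite lerDl.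
  apply: lt_le_trans (ler_eXnr m0 a1'); apply: le_lt_trans a1.
  by rewrite lerDr.
have sD k : 1 + N (delta_mx 0 k) <= \sum_k (1 + N (delta_mx 0 k)).
  by rewrite (bigD1 k) //= lerDl sumr_ge0 // => l _; rewrite addr_ge0.
have [->|ij] := eqVneq i j.
  by have /andP[a0 aN] := dA j; rewrite ger0_norm // (le_trans aN).
have ijs : A i i + A j j <= \sum_k (1 + N (delta_mx 0 k)).
  rewrite (bigD1 i) //= (bigD1 j) 1?eq_sym //= addrA.
  apply: (@le_trans _ _ (1 + N (delta_mx 0 i) + (1 + N (delta_mx 0 j)))).
    by apply: lerD; [case/andP: (dA i)|case/andP: (dA j)].
  by rewrite lerDl sumr_ge0 // => l _; rewrite addr_ge0.
have qE (s : R) : qform A (delta_mx 0 i + s *: delta_mx 0 j) = A i i + s * (2 * A i j) + s * s * A j j.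
  have mD (M P : 'M[R]_1) : (M + P) 0 0 = M 0 0 + P 0 0 by rewrite !mxE.
  have mZ (k : R) (M : 'M[R]_1) : (k *: M) 0 0 = k * M 0 0 by rewrite mxE.
  rewrite /qform !mulmxDl -!scalemxAl [(_ + _)^T]linearD /= [(_ *: _)^T]linearZ /=.
  rewrite !mulmxDr -!scalemxAr !(mD, mZ) !dE.
  have -> : A j i = A i j by rewrite -[in LHS]At mxE.
  by ring.
have := A0 (delta_mx 0 i + 1 *: delta_mx 0 j); rewrite qE => -[h1 _].
have := A0 (delta_mx 0 i + (- 1) *: delta_mx 0 j); rewrite qE => -[h2 _].
rewrite ler_norml; have /andP[? _] := dA i; have /andP[? _] := dA j.
by apply/andP; split; lra.
Qed.

(** Provides a positive definite competitor, a multiple of the identity. [N] has a positive minimum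
    on the Euclidean unit sphere, and homogeneity does the rest. *)
Lemma homogeneous_lower_bound m q (N : 'rV[R]_q -> R) : (0 < m)%N ->
  continuous N -> (forall x, x != 0 -> 0 < N x) ->
  (forall (t : R) x, N (t *: x) = t ^+ (2 * m) * N x) ->
  exists2 d : R, 0 < d & forall x : 'rV[R]_q, (d * (x *m x^T) 0 0) ^+ m <= N x.
Proof.
move=> m0 cN N0 hN.
pose s (x : 'rV[R]_q) : R := (x *m x^T) 0 0.
have sE x : s x = \sum_i x 0 i * x 0 i by rewrite /s mxE; apply: eq_bigr => i _; rewrite mxE.
have cs : continuous s.
  move=> x; rewrite (_ : s = fun x => \sum_i x 0 i * x 0 i); last exact/funext.
  by apply: (@cvg_sumR R _ (nbhs x) _) => i; apply: cvgM; exact: coord_continuous.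
have N00 : N 0 = 0 by rewrite -(scale0r 0) hN expr0n muln_eq0 /= eqn0Ngt m0 mul0r.
pose K := s @^-1` [set 1].
have K0 x : K x -> x != 0.
  move=> Kx; apply/eqP => x0; move: Kx; rewrite /K /= x0 /s mul0mx mxE => /esym/eqP.
  by rewrite oner_eq0.
have cK : compact K.
  apply: bounded_closed_compact; last first.
    by have /continuous_closedP := cs; apply; exact: closed_eq.
  exists 1; split=> // M M1 x Kx; apply: le_trans (ltW M1).
  apply/row_norm_le => // i.
  rewrite -(@ler_pXn2r _ 2) ?nnegrE // expr1n -normrX ger0_norm ?sqr_ge0 //.
  rewrite -[leRHS]Kx sE (bigD1 i) //= lerDl sumr_ge0 // => j _; exact: sqr_ge0.
have [d d0 dK] : exists2 d : R, 0 < d & forall x, K x -> d <= N x.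
  have [KN|/set0P KN] := eqVneq K set0; first by exists 1 => // x; rewrite KN.
  have [|c] := @compact_EVT_min _ R N K KN cK; first exact: continuous_subspaceT.
  rewrite inE => Kc cm; exists (N c); first exact/N0/K0.
  by move=> x Kx; apply: cm; rewrite inE.
(* The cap at 1 makes the m-th power of the constant at most the constant itself. *)
exists (Num.min 1 d); first by rewrite lt_min ltr01.
have e0 : 0 < Num.min 1 d by rewrite lt_min ltr01.
move=> x; rewrite -/(s x); have [->|x0] := eqVneq x 0.
  by rewrite N00 /s mul0mx mxE mulr0 expr0n eqn0Ngt m0.
have sx : 0 < s x.
  rewrite lt0r mulmx_tr_ge0 andbT; apply: contra x0 => /eqP /mulmx_tr_eq0 ->; exact: eqxx.
pose r := Num.sqrt (s x); have r0 : 0 < r by rewrite sqrtr_gt0.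
have rr : r ^+ 2 = s x by rewrite sqr_sqrtr // ltW.
have -> : x = r *: (r^-1 *: x) by rewrite scalerA divff ?gt_eqF // scale1r.
rewrite hN exprM rr [s (r *: _)](_ : _ = s x); last first.
  by rewrite scalerA divff ?gt_eqF // scale1r.
rewrite exprMn mulrC ler_wpM2l ?exprn_ge0 ?(ltW sx) //.
apply: (@le_trans _ _ (Num.min 1 d)).
  by rewrite ler_iXnr // ?(ltW e0) // ge_min lexx.
apply: (@le_trans _ _ d); first by rewrite ge_min lexx orbT.
apply: dK; rewrite /K /= sE; under eq_bigr do rewrite !mxE mulrACA.
by rewrite -mulr_sumr -sE -invfM -expr2 rr mulVf // gt_eqF.
Qed.

Lemma closed_preimage (T U : topologicalType) (f : T -> U) (A : set U) :
  continuous f -> closed A -> closed (f @^-1` A).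
Proof. by move=> /continuous_closedP; exact. Qed.

Lemma closed_bigcap (T : topologicalType) (I : Type) (D : set I) (A : I -> set T) :
  (forall i, D i -> closed (A i)) -> closed (\bigcap_(i in D) A i).
Proof.
move=> cA x clx i Di; apply: cA => //.
by apply: closure_subset clx; exact: bigcap_inf.
Qed.

Lemma loewner_exists m q (N : 'rV[R]_q -> R) : (0 < m)%N ->
  continuous N -> (forall x, x != 0 -> 0 < N x) ->
  (forall (t : R) x, N (t *: x) = t ^+ (2 * m) * N x) ->
  exists A, loewner m N A.
Proof.
move=> m0 cN N0 hN; have [d d0 dN] := homogeneous_lower_bound m0 cN N0 hN.
have Nge x : 0 <= N x.
  by apply: le_trans (dN x); rewrite exprn_ge0 // mulr_ge0 ?(ltW d0) // mulmx_tr_ge0.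
have bd : below m N (d%:M).
  split; first exact: tr_scalar_mx.
  move=> x; have -> : qform d%:M x = d * (x *m x^T) 0 0.
    by rewrite /qform mul_mx_scalar -scalemxAl mxE.
  by split=> //; rewrite mulr_ge0 ?(ltW d0) // mulmx_tr_ge0.
(* Matrices are flattened so that the compactness criterion for bounded closed sets of row vectors
   applies. *)
pose K := [set v : 'rV[R]_(q * q) | below m N (vec_mx v)].
have cE (v : 'rV[R]_(q * q)) i j : (vec_mx w : 'M[R]_q) i j @[w --> v] --> (vec_mx v : 'M[R]_q) i j.
  rewrite (_ : (fun w => _) = fun w : 'rV[R]_(q * q) => w 0 (mxvec_index i j)).
    by rewrite mxE; exact: coord_continuous.
  by apply/funext => w; rewrite mxE.
have cK : compact K.
  apply: bounded_closed_compact.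
    exists (\sum_k (1 + N (delta_mx 0 k))); split=> [|M M1 v Kv]; first exact: num_real.
    apply: le_trans (ltW M1); apply/row_norm_le => [|k].
      by apply: sumr_ge0 => k _; rewrite addr_ge0.
    case/mxvec_indexP: k => i j; have := below_entry i j m0 Nge Kv.
    by rewrite mxE.
  rewrite (_ : K = (\bigcap_(ij : 'I_q * 'I_q)
      ((fun v : 'rV[R]_(q * q) => vec_mx v ij.1 ij.2 - vec_mx v ij.2 ij.1) @^-1` [set 0])) `&`
      (\bigcap_(x : 'rV[R]_q) ((fun v => qform (vec_mx v) x) @^-1` [set y | 0 <= y] `&`
        (fun v => qform (vec_mx v) x ^+ m) @^-1` [set y | y <= N x]))).
    apply: closedI; apply: closed_bigcap => k _; last apply: closedI.
    - apply: closed_preimage; last exact: closed_eq.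
      by move=> v; exact: (cvgB (cE v k.1 k.2) (cE v k.2 k.1)).
    - apply: closed_preimage; last exact: closed_ge.
      by move=> v; apply: (@qform_cvg _ (nbhs v)) => i j; exact: cE.
    - apply: closed_preimage; last exact: closed_le.
      move=> v; apply: (@continuous_comp _ _ _ (fun v => qform (vec_mx v) k) (fun y => y ^+ m)).
        by apply: (@qform_cvg _ (nbhs v)) => i j; exact: cE.
      exact: exprn_continuous.
  apply/seteqP; split=> v /=.
    move=> [vt v0]; split=> [[i j] _ /=|x _ /=]; last by have [] := v0 x.
    by rewrite -[in X in X - _]vt [X in X - _]mxE subrr.
  move=> [vt v0]; split; last by move=> x; have [] := v0 x I.
  apply/matrixP => i j; rewrite mxE; apply/eqP; rewrite -subr_eq0; apply/eqP.
  exact: (vt (j, i) I).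
have K0 : K !=set0 by exists (mxvec d%:M); rewrite /K /= mxvecK.
have [|v] := @compact_EVT_max _ R (fun v => \det (vec_mx v : 'M[R]_q)) K K0 cK.
  by apply: continuous_subspaceT => v; apply: (@det_cvg _ (nbhs v)) => i j; exact: cE.
rewrite inE => Kv vm; exists (vec_mx v).
have vm' B : below m N B -> \det B <= \det (vec_mx v).
  by move=> bB; have := vm (mxvec B); rewrite inE /K /= mxvecK; apply.
(* The competitor [d%:M] makes the maximal determinant positive. *)
split=> //; apply: lt_le_trans (vm' _ bd).
by rewrite det_scalar exprn_gt0.
Qed.

Lemma below_conj m q (N : 'rV[R]_q -> R) (J A : 'M[R]_q) : below m N A ->
  below m (fun x => N (x *m J)) (J *m A *m J^T).
Proof.
move=> [At A0]; split; first by rewrite !trmx_mul trmxK At mulmxA.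
by move=> x; rewrite qform_mul.
Qed.

(** A change of basis is a bijection between admissible forms and multiplies all determinants by the
    same factor [\det J ^+ 2]. *)
Lemma loewner_conj m q (N : 'rV[R]_q -> R) (J A : 'M[R]_q) : J \in unitmx ->
  loewner m N A -> loewner m (fun x => N (x *m J)) (J *m A *m J^T).
Proof.
move=> Ju [bA dA mA].
have dJ : 0 < \det J ^+ 2 by rewrite exprn_even_gt0 //= -unitfE -unitmxE.
have dE B : \det (J *m B *m J^T) = \det J ^+ 2 * \det B.
  by rewrite !det_mulmx det_tr mulrAC -expr2.
split; [exact: below_conj|by rewrite dE mulr_gt0|].
move=> B bB; rewrite dE.
have -> : B = J *m (invmx J *m B *m (invmx J)^T) *m J^T.
  by rewrite -!mulmxA -trmx_mul mulmxV // trmx1 mulmx1 mulKVmx.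
rewrite dE ler_pM2l //; apply: mA.
have := below_conj (invmx J) bB; congr (below m _ _).
by apply/funext => x; rewrite mulmxKV.
Qed.

End QuadraticForms.

(** * Charts and bump functions *)

(** Both [Q] and its complement are relatively open in [C], being traces on [C] of unions of the
    chosen neighbourhoods. *)
Lemma connected_locally_constant (T : topologicalType) (C Q : set T) : connected C ->
  (forall w : T, C w -> exists O, [/\ open O, O w &
     forall w' : T, C w' -> O w' -> (Q w <-> Q w')]) ->
  forall u v : T, C u -> C v -> Q u -> Q v.
Proof.
move=> cC loc u v Cu Cv Qu.
pose O (w : T) := if pselect (C w) is left Cw then sval (cid (loc w Cw)) else set0.
have OP (w : T) : C w -> [/\ open (O w), O w w & forall w' : T, C w' -> O w w' -> (Q w <-> Q w')].
  by move=> Cw; rewrite /O; case: pselect => // Cw'; exact: (svalP (cid (loc w Cw'))).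
have oO (w : T) : open (O w).
  rewrite /O; case: pselect => [Cw|_]; last exact: open0.
  by case: (svalP (cid (loc w Cw))).
suff E : C `&` Q = C by have [] : (C `&` Q) v by rewrite E.
have EO (S : set T) : (forall w w' : T, C w -> C w' -> O w w' -> S w -> S w') ->
    C `&` S = C `&` \bigcup_(w in C `&` S) O w.
  move=> SP; apply/seteqP; split=> [w [Cw Sw]|w' [Cw' [w [Cw Sw] Oww']]].
    by split=> //; exists w => //; have [] := OP _ Cw.
  by split=> //; exact: SP Oww' Sw.
apply: cC; first by exists u.
- exists (\bigcup_(w in C `&` Q) O w); first by apply: bigcup_open => w _; exact: oO.
  by apply: EO => w w' Cw Cw' Oww'; have [_ _ /(_ w' Cw' Oww')[]] := OP w Cw.
- exists (~` \bigcup_(w in C `&` ~` Q) O w).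
    by apply: open_closedC; apply: bigcup_open => w _; exact: oO.
  have EN : C `&` ~` Q = C `&` \bigcup_(w in C `&` ~` Q) O w.
    apply: EO => w w' Cw Cw' Oww' nQ Qw'; apply: nQ.
    by have [_ _ /(_ w' Cw' Oww')[_]] := OP w Cw; exact.
  apply/seteqP; split=> [w [Cw Qw]|w [Cw nb]].
    split=> // wb; have : (C `&` ~` Q) w by rewrite EN.
    by case.
  split=> //; apply: contrapT => nQ; apply: nb.
  by exists w => //; have [] := OP _ Cw.
Qed.

Section Charts.
Context {R : realType} {n : nat} {M : topologicalType}.
Implicit Types c d e : chart R n M.

Lemma chart_image_inv c x : chart_image c x ->
  chart_dom c (chart_inv c x) /\ c (chart_inv c x) = x.
Proof. by move=> [z cz <-]; rewrite chart_mapK. Qed.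

Lemma chart_open c (V : set M) : open V -> open [set c z | z in chart_dom c `&` V].
Proof.
move=> oV; rewrite openE => _ [z [cz Vz] <-]; rewrite /interior.
have ic : (c @` chart_dom c) (c z) by exists z.
have n1 : \forall x \near c z, (c @` chart_dom c) x.
  by apply: open_nbhs_nbhs; split=> //; exact: chart_image_open.
have n2 : \forall x \near c z, V (chart_inv c x).
  apply: (chart_inv_continuous ic); rewrite chart_mapK //; exact: open_nbhs_nbhs.
near=> x.
have [w cw wx] : (c @` chart_dom c) x by near: x.
exists w => //; split=> //; have : V (chart_inv c x) by near: x.
by rewrite -wx chart_mapK.
Unshelve. all: by end_near. Qed.

Lemma chart_image_openT c : open (chart_image c).
Proof. exact: chart_image_open. Qed.

Lemma smooth_change c d (V : set M) (f : M -> R) : open V -> smooth_transition c d ->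
  smooth_on [set d z | z in chart_dom d `&` V] (fun t => f (chart_inv d t)) ->
  smooth_on [set c z | z in chart_dom c `&` (chart_dom d `&` V)]
    (fun t => f (chart_inv c t)).
Proof.
move=> oV tcd sf.
have oU : open [set c z | z in chart_dom c `&` (chart_dom d `&` V)].
  by apply: chart_open; apply: openI => //; exact: chart_dom_open.
apply: (@smooth_on_eq _ _ _ _ (fun t => f (chart_inv d (d (chart_inv c t))))) => //.
  by move=> _ [z [cz [dz Vz]] <-]; rewrite !chart_mapK.
apply: (@smooth_comp R n n _ [set d z | z in chart_dom d `&` V]
  (fun t => d (chart_inv c t)) (fun t => f (chart_inv d t))) => //.
- exact: chart_open.
- by move=> _ [z [cz [dz Vz]] <-]; rewrite chart_mapK //; exists z.
- move=> j; apply: (smooth_on_sub _ (tcd j)).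
  by move=> _ [z [cz [dz Vz]] <-]; exists z.
Qed.

End Charts.

Section Manifolds.
Context {R : realType} {n : nat} {M : manifold R n}.
Implicit Types c d e : chart R n M.

(** By definition a smooth chart is compared only with the atlas, so near each point the transition
    is factored through an atlas chart. *)
Lemma smooth_chart_transition c e : smooth_chart c -> smooth_chart e ->
  smooth_transition c e.
Proof.
move=> sc se j; apply: smooth_on_local => _ [z [cz ez] <-].
have [d ad dz] := @atlas_cover _ _ M z.
have [cd _] := sc _ ad; have [_ de] := se _ ad.
exists [set c z | z in chart_dom c `&` (chart_dom d `&` chart_dom e)].
exists (fun t => e (chart_inv c t) 0 j); split=> //.
- by apply: chart_open; apply: openI; exact: chart_dom_open.
- by exists z.
- apply: (@smooth_change _ _ _ c d (chart_dom e) (fun z => e z 0 j)) => //.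
    exact: chart_dom_open.
Qed.

(** The open set [V] admits functions that are smooth only near [z], such as the coordinates of a
    third chart. *)
Lemma chain_rule_chart c d (V : set M) (f : M -> R) z k : smooth_chart c -> smooth_chart d ->
  open V -> smooth_on [set d w | w in chart_dom d `&` V] (fun t => f (chart_inv d t)) ->
  chart_dom c z -> chart_dom d z -> V z ->
  partial k (fun t => f (chart_inv c t)) (c z) =
  \sum_l partial l (fun t => f (chart_inv d t)) (d z) *
     partial k (fun t => d (chart_inv c t) 0 l) (c z).
Proof.
move=> sc sd oV sf cz dz Vz; have tcd := smooth_chart_transition sc sd.
have oU : open [set c z | z in chart_dom c `&` (chart_dom d `&` V)].
  by apply: chart_open; apply: openI => //; exact: chart_dom_open.
have Uz : [set c z | z in chart_dom c `&` (chart_dom d `&` V)] (c z) by exists z.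
have oW : open [set d w | w in chart_dom d `&` V] by exact: chart_open.
rewrite (@partial_eq _ _ _ _ (fun t => f (chart_inv d (d (chart_inv c t)))) k _ oU Uz); last first.
  by move=> _ [w [cw [dw Vw]] <-]; rewrite !chart_mapK.
rewrite /partial (@chain_rule R n n (fun t => d (chart_inv c t)) (fun t => f (chart_inv d t))).
- by rewrite chart_mapK.
- move=> j; apply: (smooth_differentiable oU) => //; apply: (smooth_on_sub _ (tcd j)).
  by move=> _ [w [cw [dw Vw]] <-]; exists w.
- by apply: (smooth_differentiable oW) => //; rewrite chart_mapK //; exists z.
Qed.

Definition smooth_function (f : M -> R) : Prop :=
  forall c, smooth_chart c -> smooth_on (chart_image c) (fun t => f (chart_inv c t)).

(* [chi] is a bump function supported in the chart, and [f] is [chi * h] extended by zero. *)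
Lemma smooth_extension c z0 (h : 'rV[R]_n -> R) : smooth_chart c -> chart_dom c z0 ->
  smooth_on (chart_image c) h ->
  exists f chi, [/\ smooth_function f, smooth_on (chart_image c) chi, chi (c z0) = 1
    & forall t, chart_image c t -> f (chart_inv c t) = chi t * h t].
Proof.
move=> sc cz0 sh; pose t0 := c z0.
have oI : open (chart_image c) by exact: chart_image_openT.
have It0 : chart_image c t0 by exists z0.
have [e /= e0 eI] : exists2 e : R, 0 < e & ball t0 e `<=` chart_image c.
  by have /nbhs_ballP[e] := open_nbhs_nbhs (conj oI It0); exists e.
(* With [r < e], the closed Euclidean ball of radius [r] lies in the open sup-norm ball of radius
   [e]. *)
pose r := e / 2; have r0 : 0 < r by rewrite divr_gt0.
pose s (t : 'rV[R]_n) : R := \sum_j (t 0 j + - t0 0 j) ^+ 2.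
have scoord j : smooth_on setT (fun t : 'rV[R]_n => t 0 j + - t0 0 j).
  apply: smoothD; [exact: openT|exact: smooth_coord|apply: smooth_cst; exact: openT].
have ss : smooth_on setT s.
  by apply: smooth_sum => [|j]; [exact: openT|apply: smoothX => //; exact: openT].
have s_ge0 t : 0 <= s t by apply: sumr_ge0 => j _; exact: sqr_ge0.
pose g t := r ^+ 2 + (-1) * s t.
have sg : smooth_on setT g.
  apply: smoothD; [exact: openT|apply: smooth_cst; exact: openT|].
  by apply: smoothM; [exact: openT|apply: smooth_cst; exact: openT|].
have fr : 0 < flat 0 (r ^+ 2) by rewrite flat_gt0 // exprn_gt0.
pose chi t := flat 0 (g t) * (flat 0 (r ^+ 2))^-1.
have schi : smooth_on (chart_image c) chi.
  apply: (@smooth_on_sub R n setT); first exact: subsetT.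
  apply: smoothM; [exact: openT| |apply: smooth_cst; exact: openT].
  by apply: smooth_flat; first exact: openT.
pose K := [set t | s t <= r ^+ 2].
have Kt0 t : K t -> `|t0 - t| < e.
  move=> Kt.
  apply: (@le_lt_trans _ _ r); last by rewrite /r ltr_pdivrMr // ltr_pMr // ltr1n.
  apply/row_norm_le; rewrite ?(ltW r0) // => i.
  rewrite -(@ler_pXn2r _ 2) ?nnegrE ?(ltW r0) // -normrX ger0_norm ?sqr_ge0 //.
  apply: le_trans Kt; rewrite /s (bigD1 i) //= !mxE -sqrrN opprB lerDl.
  by apply: sumr_ge0 => j _; exact: sqr_ge0.
have KI : K `<=` chart_image c by move=> t /Kt0 Kt; apply: eI; rewrite -ball_normE.
have cs : continuous s by move=> t; have [] := ss [::] t I.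
have cK : compact K.
  apply: bounded_closed_compact; last first.
    exact: (closed_preimage cs (closed_le (y := r ^+ 2))).
  exists (`|t0| + e); split; first exact: num_real.
  move=> x xM t /Kt0 Kt /=; apply: le_trans (ltW xM).
  have -> : t = t0 - (t0 - t) by rewrite opprB addrCA subrr addr0.
  by apply: le_trans (ler_normB _ _) _; rewrite lerD2l ltW.
pose Z := chart_inv c @` K.
(* Outside [Z] the extension is zero. Being compact in a Hausdorff space, [Z] is closed, so its
   complement and the chart domain form an open cover of [M]. *)
have cZ : closed Z.
  apply: compact_closed; first exact: manifold_hausdorff.
  apply: continuous_compact => //; apply: continuous_in_subspaceT => t; rewrite inE => /KI.
  exact: chart_inv_continuous.
pose f z := if pselect (chart_dom c z) then chi (c z) * h (c z) else 0.
have fE t : chart_image c t -> f (chart_inv c t) = chi t * h t.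
  by move=> /chart_image_inv[ct tE]; rewrite /f tE; case: pselect.
have fZ z : ~ Z z -> f z = 0.
  rewrite /f; case: pselect => // cz nZ; rewrite /chi /flat ifF ?mul0r //.
  apply: contra_notF nZ; rewrite /g mulN1r subr_gt0 => sr; exists (c z); last exact: chart_mapK.
  exact: ltW.
exists f, chi; split=> //.
- move=> d sd; apply: smooth_on_local => _ [z dz <-].
  have [cz|ncz] := pselect (chart_dom c z).
    exists [set d z | z in chart_dom d `&` (chart_dom c `&` setT)], (fun t => f (chart_inv d t)).
    split=> //.
    + by apply: chart_open; apply: openI; [exact: chart_dom_open|exact: openT].
    + by exists z.
    + apply: smooth_change; [exact: openT|exact: smooth_chart_transition|].
      by rewrite setIT; apply: (smooth_on_eq oI fE); exact: smoothM.
  exists [set d z | z in chart_dom d `&` ~` Z], (fun=> 0).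
  have oW : open [set d z | z in chart_dom d `&` ~` Z].
    by apply: chart_open; exact: closed_openC.
  split=> //.
  + exists z => //; split=> // -[t /KI /chart_image_inv[ct _] tz].
    by apply: ncz; rewrite -tz.
  + exact: smooth_cst.
  + by move=> _ [w [dw nZ] <-]; rewrite chart_mapK // fZ.
- have s0 : s t0 = 0 by rewrite /s big1 // => j _; rewrite subrr expr0n.
  by rewrite /chi /g -/t0 s0 mulr0 addr0 divff // gt_eqF.
Qed.

(** Transparent, because [basic_form_power] computes with its values. *)
Definition power_Cinfty (f : M -> R) (sf : smooth_function f) (m : nat) : Cinfty M.
Proof.
apply: (@MkCinfty R n M (fun z => (f z ^+ m)%:C%C)) => c sc; split => /=.
  by apply: smoothX; [exact: chart_image_openT|exact: sf].
by apply: smooth_cst; exact: chart_image_openT.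
Defined.

End Manifolds.

(** * Multi-indices as lists of coordinate indices *)

Section MultiIndexDerivatives.
Context {R : realType}.

Lemma foldr_partial_C_real n (g : 'rV[R]_n -> R) (l : seq 'I_n) :
  foldr (@partial_C R n) (fun t => (g t)%:C%C) l = (fun t => (foldr partial g l t)%:C%C).
Proof.
elim: l => [//|i l IHl]; rewrite [LHS]/= IHl; apply/funext => t.
by rewrite /partial_C /= /partial derive_cst.
Qed.

Definition index_seq p q m (s : multi_index (q := q) m) : seq 'I_(p + q) :=
  flatten [seq nseq (s j) (rshift p j) | j <- enum 'I_q].

Lemma partial_yE p q m (s : multi_index (q := q) m) (f : 'rV[R]_(p + q) -> R[i]) :
  partial_y s f = foldr (@partial_C R (p + q)) f (index_seq p s).
Proof.
rewrite /partial_y /index_seq; elim: (enum _) => //= j r ->.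
by rewrite foldr_cat; elim: (nat_of_ord (s j)) => //= k ->.
Qed.

Lemma size_index_seq p q m (s : multi_index (q := q) m) : size (index_seq p s) = weight s.
Proof.
rewrite size_flatten /shape -map_comp sumnE big_map big_enum /weight /=.
by apply: eq_bigr => j _; rewrite size_nseq.
Qed.

Lemma prod_index_seq p q m (s : multi_index (q := q) m) (xi : 'I_(p + q) -> R) :
  \prod_(i <- index_seq p s) xi i = \prod_(j < q) xi (rshift p j) ^+ s j.
Proof.
rewrite big_flatten big_map big_enum; apply: eq_bigr => j _ /=.
by rewrite big_nseq; elim: (nat_of_ord (s j)) => [|k IHk]; rewrite ?expr0 //= exprS IHk.
Qed.

End MultiIndexDerivatives.

(** * Principal symbols on foliated manifolds *)

Section Foliations.
Context {R : realType} {p q : nat} {M : manifold R (p + q)}.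
Variable F : foliation M.
Implicit Types (c d e : chart R (p + q) M) (z w : M).

(** The same expression as the matrix [J] in [metric_change]. *)
Definition transverse_jacobian c d z : 'M[R]_q := \matrix_(a < q, b < q)
  partial (rshift p b) (fun t => ycoord d (chart_inv c t) 0 a) (c z).

Lemma ycoordE c z j : ycoord c z 0 j = c z 0 (rshift p j).
Proof. by rewrite mxE. Qed.

Lemma ycoord_fun c d j : (fun t => ycoord d (chart_inv c t) 0 j) =
  (fun t => d (chart_inv c t) 0 (rshift p j)).
Proof. by apply/funext => t; rewrite ycoordE. Qed.

Lemma smooth_ycoord c d j : smooth_chart c -> smooth_chart d ->
  smooth_on [set c z | z in chart_dom c `&` chart_dom d]
    (fun t => ycoord d (chart_inv c t) 0 j).
Proof. by move=> sc sd; rewrite ycoord_fun; exact: smooth_chart_transition. Qed.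

(** Leaf and transverse coordinates of [d] are separated because the first sum vanishes as soon as
    [d] and [e] have the same leaf directions. *)
Lemma chain_rule_ycoord c d e z k j : smooth_chart c -> smooth_chart d -> smooth_chart e ->
  chart_dom c z -> chart_dom d z -> chart_dom e z ->
  partial k (fun t => ycoord e (chart_inv c t) 0 j) (c z) =
  \sum_(i < p) partial (lshift q i) (fun t => ycoord e (chart_inv d t) 0 j) (d z) *
     partial k (fun t => d (chart_inv c t) 0 (lshift q i)) (c z) +
  \sum_(b < q) partial (rshift p b) (fun t => ycoord e (chart_inv d t) 0 j) (d z) *
     partial k (fun t => ycoord d (chart_inv c t) 0 b) (c z).
Proof.
move=> sc sd se cz dz ez.
rewrite (@chain_rule_chart R _ M c d (chart_dom e) (fun w => ycoord e w 0 j) z k) //.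
- rewrite big_split_ord /=; congr (_ + _).
  by apply: eq_bigr => b _; rewrite (ycoord_fun c d b).
- exact: chart_dom_open.
- exact: smooth_ycoord.
Qed.

Lemma partial_self c z k l : chart_dom c z ->
  partial k (fun t => c (chart_inv c t) 0 l) (c z) = (k == l)%:R.
Proof.
move=> cz; rewrite -(partial_coord k l (c z)).
apply: (@partial_eq _ _ (chart_image c)); first exact: chart_image_openT.
  by exists z.
by move=> t /chart_image_inv[_ ->].
Qed.

Lemma foliated_smooth c : foliated_chart F c -> smooth_chart c.
Proof. by case. Qed.

(* Both [c] and [e] are compared with a chart of the foliated atlas; the block of the
   inverse Jacobian which is known to vanish forces the other one to vanish. *)
Lemma foliated_same_leaf c e : foliated_chart F c -> foliated_chart F e ->
  same_leaf_directions c e.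
Proof.
move=> fc fe z cz ez i j.
have [d ad dz] := fatlas_cover F z.
have sc := foliated_smooth fc; have se := foliated_smooth fe.
have sd : smooth_chart d := fatlas_smooth ad.
pose X := \matrix_(a < q, b < p) partial (lshift q b) (fun t => ycoord e (chart_inv d t) 0 a) (d z).
pose C := transverse_jacobian d e z; pose C' := transverse_jacobian e d z.
have CX : C' *m X = 0.
  apply/matrixP => a b; rewrite !mxE.
  have := chain_rule_ycoord (lshift q b) a sd se sd dz ez dz.
  rewrite ycoord_fun partial_self // eq_lrshift => E.
  move: E; rewrite big1 ?add0r => [E|k _].
    by rewrite [RHS]E; apply: eq_bigr => k _; rewrite !mxE.
  by rewrite (fe.2 d ad z ez dz) mul0r.
have CC : C' *m C = 1%:M.
  apply/matrixP => a b; rewrite !mxE.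
  have := chain_rule_ycoord (rshift p b) a sd se sd dz ez dz.
  rewrite ycoord_fun partial_self // eq_rshift eq_sym => E.
  move: E; rewrite big1 ?add0r => [E|k _].
    by rewrite [RHS]E; apply: eq_bigr => k _; rewrite !mxE.
  by rewrite (fe.2 d ad z ez dz) mul0r.
have X0 : X = 0 by rewrite -[X]mul1mx -(mulmx1C CC) -mulmxA CX mulmx0.
rewrite (chain_rule_ycoord (lshift q i) j sc sd se cz dz ez).
rewrite big1 ?add0r => [|k _]; last first.
  by move/matrixP/(_ j k): X0; rewrite !mxE => ->; rewrite mul0r.
by rewrite big1 // => k _; rewrite (fc.2 d ad z cz dz) mulr0.
Qed.

Lemma transverse_jacobian_cocycle c d e z :
  foliated_chart F c -> foliated_chart F d -> foliated_chart F e ->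
  chart_dom c z -> chart_dom d z -> chart_dom e z ->
  transverse_jacobian c e z = transverse_jacobian d e z *m transverse_jacobian c d z.
Proof.
move=> fc fd fe cz dz ez; apply/matrixP => a b; rewrite !mxE.
rewrite (chain_rule_ycoord _ _ (foliated_smooth fc) (foliated_smooth fd) (foliated_smooth fe) cz dz ez).
rewrite big1 ?add0r => [|i _]; last by rewrite (foliated_same_leaf fd fe dz ez) mul0r.
by apply: eq_bigr => k _; rewrite !mxE.
Qed.

Lemma transverse_jacobian_self c z : chart_dom c z -> transverse_jacobian c c z = 1%:M.
Proof.
move=> cz; apply/matrixP => a b; rewrite !mxE ycoord_fun partial_self //.
by rewrite eq_rshift eq_sym.
Qed.

Lemma transverse_jacobianK c d z : foliated_chart F c -> foliated_chart F d ->
  chart_dom c z -> chart_dom d z ->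
  transverse_jacobian c d z *m transverse_jacobian d c z = 1%:M.
Proof.
move=> fc fd cz dz; rewrite -(transverse_jacobian_cocycle fd fc fd dz cz dz).
exact: transverse_jacobian_self.
Qed.

Lemma transverse_jacobian_unit c d z : foliated_chart F c -> foliated_chart F d ->
  chart_dom c z -> chart_dom d z -> transverse_jacobian c d z \in unitmx.
Proof. by move=> fc fd cz dz; case/mulmx1_unit: (transverse_jacobianK fc fd cz dz). Qed.

Lemma smooth_transverse_jacobian c d a b : smooth_chart c -> smooth_chart d ->
  smooth_on [set c z | z in chart_dom c `&` chart_dom d]
    (fun t => transverse_jacobian c d (chart_inv c t) a b).
Proof.
move=> sc sd.
apply: (smooth_on_eq _ _ (smooth_partial (rshift p b) (smooth_ycoord a sc sd))).
  by apply: chart_open; exact: chart_dom_open.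
by move=> _ [z [cz dz] <-]; rewrite mxE !chart_mapK.
Qed.

Section PrincipalSymbol.
Variables (m : nat) (P : Cinfty M -> Cinfty M).

(** The m-th power isolates the top order: its derivatives of order below m keep a factor [f z = 0],
    and one of order m is m! times a product of first derivatives. *)
Lemma basic_form_power c (a : multi_index m -> 'rV[R]_q -> R[i]) (f : M -> R)
    (sf : smooth_function f) z :
  basic_form F P c a -> chart_dom c z -> f z = 0 ->
  P (power_Cinfty sf m) z = (m`!)%:R * symbol a (ycoord c z)
    (\row_j partial (rshift p j) (fun t => f (chart_inv c t)) (c z)).
Proof.
move=> [fc _ PE] cz fz; rewrite PE //.
have oI : open (chart_image c) by exact: chart_image_openT.
have Iz : chart_image c (c z) by exists z.
have sh := sf _ (foliated_smooth fc).
pose h t := f (chart_inv c t).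
have D (s : multi_index m) : (weight s <= m)%N ->
    partial_y s (fun t => power_Cinfty sf m (chart_inv c t)) (c z) =
    if weight s == m then (m`!)%:R * (\prod_(j < q) partial (rshift p j) h (c z) ^+ s j)%:C%C else 0.
  move=> sm; rewrite partial_yE /= (foldr_partial_C_real (fun t => h t ^+ m)).
  have [|w _ ->] := @partials_power _ _ _ _ m (index_seq p s) oI sh; rewrite ?size_index_seq //.
  rewrite -/h chart_mapK // fz exprS mul0r mul0r addr0 prod_index_seq.
  case: eqVneq => [->|sm'].
    by rewrite subnn expr0 mulr1 ffactnn rmorphM rmorph_nat.
  have -> : (m - weight s = (m - weight s).-1.+1)%N.
    by rewrite prednK // subn_gt0 ltn_neqAle sm' sm.
  by rewrite exprS mul0r mulr0 mul0r.
rewrite (bigID (fun s => weight s == m)) /= [X in _ + X]big1 ?addr0 => [|s /andP[sm sm']]; last first.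
  by rewrite D // (negbTE sm') mulr0.
rewrite /symbol mulr_sumr; apply: eq_big => [s|s /andP[sm sm']].
  by case: eqVneq => [->|]; rewrite ?leqnn // andbF.
rewrite D // sm' mulrCA rmorph_prod; congr (_ * (_ * _)).
by apply: eq_bigr => j _; rewrite rmorphXn mxE.
Qed.

(** Both symbols are read off from the same number, the value at [z] of [P] on an m-th power, which
    involves no chart. *)
Lemma symbol_change c d (a b : multi_index m -> 'rV[R]_q -> R[i]) z xi :
  basic_form F P c a -> basic_form F P d b -> chart_dom c z -> chart_dom d z ->
  symbol a (ycoord c z) xi =
  symbol b (ycoord d z) (xi *m transverse_jacobian d c z).
Proof.
move=> ba bb cz dz.
have fc : foliated_chart F c by case: ba.
have fd : foliated_chart F d by case: bb.
have sc := foliated_smooth fc; have sd := foliated_smooth fd.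
have oT : open [set: 'rV[R]_(p + q)] by exact: openT.
have oI : open (chart_image c) by exact: chart_image_openT.
have Iz : chart_image c (c z) by exists z.
(* An affine function vanishing at [c z], with gradient [xi] along y and zero along x. *)
pose h (t : 'rV[R]_(p + q)) : R := \sum_j xi 0 j * (t 0 (rshift p j) + - c z 0 (rshift p j)).
have sc1 j : smooth_on setT (fun t : 'rV[R]_(p + q) => t 0 (rshift p j) + - c z 0 (rshift p j)).
  by apply: (smoothD oT); [exact: smooth_coord|exact: smooth_cst].
have sc2 j := smoothM oT (smooth_cst (xi 0 j) oT) (sc1 j).
have shT : smooth_on setT h by exact: smooth_sum.
have sh : smooth_on (chart_image c) h by apply: smooth_on_sub shT; exact: subsetT.
have hz : h (c z) = 0 by rewrite /h big1 // => j _; rewrite subrr mulr0.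
have [f [chi [sf schi chi1 fE]]] := smooth_extension sc cz sh.
have fz : f z = 0 by rewrite -[z in f z](chart_mapK cz) fE // hz mulr0.
have hp k : partial k h (c z) = \sum_j xi 0 j * (k == rshift p j)%:R.
  rewrite (partial_sum _ k oT I sc2).
  by apply: eq_bigr => j _; rewrite partial_affine.
(* As [h] vanishes at [c z], the derivatives of the cut-off do not contribute; [chi = 1] at this
   single point suffices. *)
have fp k : partial k (fun t => f (chart_inv c t)) (c z) = partial k h (c z).
  rewrite (partial_eq k oI Iz fE) partialM; last 2 first.
  - exact: (smooth_differentiable oI).
  - exact: (smooth_differentiable oI).
  by rewrite chi1 mul1r hz mul0r addr0.
have fx i : partial (lshift q i) (fun t => f (chart_inv c t)) (c z) = 0.
  by rewrite fp hp big1 // => j _; rewrite eq_lrshift mulr0.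
have fy j : partial (rshift p j) (fun t => f (chart_inv c t)) (c z) = xi 0 j.
  rewrite fp hp (bigD1 j) //= eqxx mulr1 big1 ?addr0 // => k kj.
  by rewrite eq_rshift eq_sym (negbTE kj) mulr0.
have E : m`!%:R * symbol a (ycoord c z) xi =
    m`!%:R * symbol b (ycoord d z) (xi *m transverse_jacobian d c z).
  rewrite -[in LHS](_ : \row_j partial (rshift p j) (fun t => f (chart_inv c t)) (c z) = xi);
    last by apply/rowP => j; rewrite mxE fy.
  rewrite -(basic_form_power sf ba cz fz) (basic_form_power sf bb dz fz).
  congr (_ * symbol _ _ _); apply/rowP => j; rewrite !mxE.
  rewrite (@chain_rule_chart R _ M d c setT f z (rshift p j)) //; last 2 first.
  - exact: openT.
  - by rewrite setIT; exact: sf.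
  rewrite big_split_ord /= big1 ?add0r => [|i _]; last by rewrite fx mul0r.
  by apply: eq_bigr => k _; rewrite fy !mxE ycoord_fun.
apply: (mulfI _ E); by rewrite pnatr_eq0 -lt0n fact_gt0.
Qed.

End PrincipalSymbol.

(** * The squared modulus of the symbol *)

Section SymbolNorm.

Definition sqnorm (w : R[i]) : R := complex.Re w ^+ 2 + complex.Im w ^+ 2.

Lemma sqnorm_gt0 (w : R[i]) : w != 0 -> 0 < sqnorm w.
Proof.
case: w => a b ab0; rewrite lt0r addr_ge0 ?sqr_ge0 // andbT.
apply: contra ab0; rewrite paddr_eq0 ?sqr_ge0 // !sqrf_eq0 /= => /andP[/eqP -> /eqP ->].
exact: eqxx.
Qed.

Lemma symbolE m (a : multi_index m -> 'rV[R]_q -> R[i]) y xi :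
  symbol a y xi = \sum_(s : multi_index m | weight s == m)
    a s y * (\prod_(j < q) xi 0 j ^+ s j)%:C%C.
Proof.
apply: eq_bigr => s _; congr (_ * _); rewrite rmorph_prod.
by apply: eq_bigr => j _; rewrite rmorphXn.
Qed.

Lemma symbol_scale m (a : multi_index m -> 'rV[R]_q -> R[i]) y (t : R) xi :
  symbol a y (t *: xi) = (t ^+ m)%:C%C * symbol a y xi.
Proof.
rewrite !symbolE mulr_sumr; apply: eq_bigr => s /eqP sm.
rewrite mulrCA -rmorphM; congr (_ * _%:C%C).
under eq_bigr do rewrite mxE exprMn.
by rewrite big_split /= prodrXr -/(weight s) sm.
Qed.

Lemma sqnorm_real (r : R) (w : R[i]) : sqnorm (r%:C%C * w) = r ^+ 2 * sqnorm w.
Proof. by case: w => a b; rewrite /sqnorm /= !mul0r subr0 addr0 !exprMn mulrDr. Qed.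

Lemma continuous_sqnorm_symbol m (a : multi_index m -> 'rV[R]_q -> R[i]) y :
  continuous (fun xi => sqnorm (symbol a y xi)).
Proof.
have cp (s : multi_index m) : continuous (fun xi : 'rV[R]_q => \prod_(j < q) xi 0 j ^+ s j).
  move=> xi; apply: (@cvg_prodR R _ (nbhs xi)) => j.
  apply: (@continuous_comp _ _ _ (fun xi : 'rV[R]_q => xi 0 j) (fun y => y ^+ s j)).
    exact: coord_continuous.
  exact: exprn_continuous.
have ReE xi : complex.Re (symbol a y xi) = \sum_(s : multi_index m | weight s == m)
    complex.Re (a s y) * \prod_(j < q) xi 0 j ^+ s j.
  rewrite symbolE (big_morph (@complex.Re R) (id1 := 0) (op1 := +%R)) // => [|[? ?] [? ?] //].
  by apply: eq_bigr => s _; case: (a s y) => u v /=; rewrite mulr0 subr0.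
have ImE xi : complex.Im (symbol a y xi) = \sum_(s : multi_index m | weight s == m)
    complex.Im (a s y) * \prod_(j < q) xi 0 j ^+ s j.
  rewrite symbolE (big_morph (@complex.Im R) (id1 := 0) (op1 := +%R)) // => [|[? ?] [? ?] //].
  by apply: eq_bigr => s _; case: (a s y) => u v /=; rewrite mulr0 add0r.
have cS (b : multi_index m -> R) : continuous (fun xi : 'rV[R]_q =>
    \sum_(s : multi_index m | weight s == m) b s * \prod_(j < q) xi 0 j ^+ s j).
  pose r := [seq s <- index_enum (multi_index (q := q) m) | weight s == m].
  rewrite (_ : (fun xi => _) = fun xi : 'rV[R]_q =>
    \sum_(s <- r) b s * \prod_(j < q) xi 0 j ^+ s j); last first.
    by apply/funext => xi; rewrite big_filter.
  move=> xi; apply: (@cvg_sumR R _ (nbhs xi)) => s.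
  by apply: cvgM; [exact: cvg_cst|exact: cp].
rewrite (_ : (fun xi => _) = fun xi : 'rV[R]_q =>
  complex.Re (symbol a y xi) * complex.Re (symbol a y xi) +
  complex.Im (symbol a y xi) * complex.Im (symbol a y xi)) //.
have cRe : continuous (fun xi => complex.Re (symbol a y xi)).
  by rewrite (funext ReE); exact: cS.
have cIm : continuous (fun xi => complex.Im (symbol a y xi)).
  by rewrite (funext ImE); exact: cS.
move=> xi; exact: (cvgD (cvgM (cRe xi) (cRe xi)) (cvgM (cIm xi) (cIm xi))).
Qed.

End SymbolNorm.

Section SmoothTranslation.

(** Translation by [x - x'] moves along the x directions, so it preserves [G] while both points stay
    in the ball. Indexing by [I] yields one neighbourhood for all matrix entries. *)
Lemma smooth_translate (I : Type) (G : I -> 'rV[R]_(p + q) -> R) x0 r x x' (U : set 'rV[R]_(p + q)) :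
  (forall i t t', ball x0 r t -> ball x0 r t' -> rsubmx t = rsubmx t' -> G i t = G i t') ->
  ball x0 r x -> ball x0 r x' -> rsubmx x = rsubmx x' ->
  open U -> U x -> (forall i, smooth_on U (G i)) ->
  exists W, [/\ open W, W x' & forall i, smooth_on W (G i)].
Proof.
move=> Gy bx bx' xx' oU Ux sG; pose v := x - x'.
pose phi (t : 'rV[R]_(p + q)) := t + v.
have oT : open [set: 'rV[R]_(p + q)] by exact: openT.
have sphi j : smooth_on setT (fun t => phi t 0 j).
  rewrite (_ : (fun t => _) = fun t : 'rV[R]_(p + q) => t 0 j + v 0 j).
    by apply: (smoothD oT); [exact: smooth_coord|exact: smooth_cst].
  by apply/funext => t; rewrite mxE.
have cphi : continuous phi.
  move=> t; apply: differentiable_continuous; apply: differentiable_row => j.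
  exact: (smooth_differentiable oT (sphi j)).
have ob : open (ball x0 r) by exact: ball_open.
have oV : open (U `&` ball x0 r) by exact: openI.
have phix : phi x' = x by rewrite /phi /v addrCA subrr addr0.
exists (ball x0 r `&` phi @^-1` (U `&` ball x0 r)).
have oW : open (ball x0 r `&` phi @^-1` (U `&` ball x0 r)).
  by apply: openI => //; apply: open_comp => // t _; exact: cphi.
split=> // [|i]; first by rewrite /= phix.
apply: (@smooth_on_eq _ _ _ _ (fun t => G i (phi t))) => //.
  move=> t [bt [_ bpt]]; apply: Gy => //.
  by rewrite /phi /v linearD linearB /= xx' subrr addr0.
apply: (@smooth_comp R _ _ _ U phi (G i)) => //.
  by move=> t [_ []].
by move=> j; apply: smooth_on_sub (sphi j); exact: subsetT.
Qed.

Lemma chart_preimage_open c (U : set 'rV[R]_(p + q)) : open U ->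
  open (chart_dom c `&` c @^-1` U).
Proof.
move=> oU; rewrite openE => z [cz Uz]; rewrite /interior.
have n1 : \forall w \near z, chart_dom c w.
  by apply: open_nbhs_nbhs; split=> //; exact: chart_dom_open.
have n2 : \forall w \near z, U (c w).
  by apply: (chart_map_continuous cz); exact: open_nbhs_nbhs.
by near=> w; split; near: w.
Unshelve. all: by end_near. Qed.

End SmoothTranslation.

(** * The normal metric and the propagation of its smoothness *)

Section TransverseMetric.
Variables (m : nat) (P : Cinfty M -> Cinfty M).
Hypothesis m_gt0 : (0 < m)%N.
Hypothesis Pbasic : basic_operator F m P.
Hypothesis Pelliptic : transversely_elliptic F m P.

Definition basic_chart z : chart R (p + q) M := sval (cid (Pbasic z)).
Definition basic_coef z : multi_index m -> 'rV[R]_q -> R[i] :=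
  sval (cid (svalP (cid (Pbasic z)))).

Lemma basic_chartP z :
  chart_dom (basic_chart z) z /\ basic_form F P (basic_chart z) (basic_coef z).
Proof. exact: (svalP (cid (svalP (cid (Pbasic z))))). Qed.

(** [P] need not have the basic form in [c], so the covector is pulled back to the y coordinates of
    a chosen basic chart, where the symbol is available. *)
Definition covector_sqnorm c z (xi : 'rV[R]_q) : R :=
  sqnorm (symbol (basic_coef z) (ycoord (basic_chart z) z)
    (xi *m transverse_jacobian (basic_chart z) c z)).

Lemma covector_sqnorm_basic c d (a : multi_index m -> 'rV[R]_q -> R[i]) z :
  foliated_chart F c -> chart_dom c z -> basic_form F P d a -> chart_dom d z ->
  covector_sqnorm c z =
    fun xi => sqnorm (symbol a (ycoord d z) (xi *m transverse_jacobian d c z)).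
Proof.
move=> fc cz ba dz; apply/funext => xi; rewrite /covector_sqnorm.
have [ez be] := basic_chartP z; have fd : foliated_chart F d by case: ba.
have fe : foliated_chart F (basic_chart z) by case: be.
rewrite (symbol_change _ ba be dz ez) -mulmxA.
by rewrite -(transverse_jacobian_cocycle fe fd fc ez dz cz).
Qed.

Lemma covector_sqnorm_change c d z :
  foliated_chart F c -> foliated_chart F d -> chart_dom c z -> chart_dom d z ->
  covector_sqnorm c z = fun xi => covector_sqnorm d z (xi *m transverse_jacobian d c z).
Proof.
move=> fc fd cz dz; have [ez be] := basic_chartP z.
have fe : foliated_chart F (basic_chart z) by case: be.
apply/funext => xi; rewrite /covector_sqnorm -mulmxA.
by rewrite -(transverse_jacobian_cocycle fe fd fc ez dz cz).
Qed.

(* Locked, like [normal_metric], because comparing two values by unfolding diverges. *)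
Definition cometric : chart R (p + q) M -> M -> 'M[R]_q :=
  locked (fun c z => xget 0 (loewner m (covector_sqnorm c z))).

Lemma cometricE c z : cometric c z = xget 0 (loewner m (covector_sqnorm c z)).
Proof. by rewrite /cometric -lock. Qed.

Lemma cometricP c z : foliated_chart F c -> chart_dom c z ->
  loewner m (covector_sqnorm c z) (cometric c z).
Proof.
move=> fc cz; rewrite cometricE; apply: xgetPex; have [ez be] := basic_chartP z.
have fe : foliated_chart F (basic_chart z) by case: be.
(* Ellipticity and homogeneity give a solution in the chosen basic chart; the Jacobian then
   transports it to [c]. *)
have [A lA] : exists A, loewner m
    (fun xi => sqnorm (symbol (basic_coef z) (ycoord (basic_chart z) z) xi)) A.
  apply: loewner_exists => //.
  - exact: continuous_sqnorm_symbol.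
  - by move=> xi xi0; apply: sqnorm_gt0; exact: Pelliptic be _ xi0.
  - by move=> t xi; rewrite symbol_scale sqnorm_real -exprM mulnC.
by eexists; exact: (loewner_conj (transverse_jacobian_unit fe fc ez cz) lA).
Qed.

Lemma cometric_unique c z A : foliated_chart F c -> chart_dom c z ->
  loewner m (covector_sqnorm c z) A -> cometric c z = A.
Proof. by move=> fc cz; apply: loewner_unique; exact: cometricP. Qed.

Definition normal_metric : chart R (p + q) M -> M -> 'M[R]_q :=
  locked (fun c z => invmx (cometric c z)).

Lemma normal_metricE c z : normal_metric c z = invmx (cometric c z).
Proof. by rewrite /normal_metric -lock. Qed.

Lemma normal_metric_posdef c z : foliated_chart F c -> chart_dom c z ->
  posdef (normal_metric c z).
Proof. by move=> fc cz; rewrite normal_metricE; apply: posdef_inv; exact: loewner_posdef (cometricP fc cz). Qed.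

Lemma normal_metric_change c d z :
  foliated_chart F c -> foliated_chart F d -> chart_dom c z -> chart_dom d z ->
  normal_metric c z =
    (transverse_jacobian c d z)^T *m normal_metric d z *m transverse_jacobian c d z.
Proof.
move=> fc fd cz dz; rewrite !normal_metricE; apply: (@invmx_conj _ _ (transverse_jacobian d c z)).
- exact: transverse_jacobianK.
- exact: posdef_unit (loewner_posdef (cometricP fd dz)).
- apply: cometric_unique => //; rewrite (covector_sqnorm_change fc fd cz dz).
  by apply: loewner_conj; [exact: transverse_jacobian_unit|exact: cometricP].
Qed.

(** On a ball inside the overlap with a basic chart [d], the y coordinates of [d] are functions of
    those of [c], hence so is their Jacobian; the symbol in [d] depends only on the y coordinates of
    [d]. *)
Lemma normal_metric_same_y c z : foliated_chart F c -> chart_dom c z ->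
  exists r, [/\ 0 < r, ball (c z) r `<=` chart_image c &
    forall t t', ball (c z) r t -> ball (c z) r t' -> rsubmx t = rsubmx t' ->
      normal_metric c (chart_inv c t) = normal_metric c (chart_inv c t')].
Proof.
move=> fc cz; have [d [a [dz ba]]] := Pbasic z; have fd : foliated_chart F d by case: ba.
have sc := foliated_smooth fc; have sd := foliated_smooth fd.
have oO : open [set c z | z in chart_dom c `&` chart_dom d].
  by apply: chart_open; exact: chart_dom_open.
have Oz : [set c z | z in chart_dom c `&` chart_dom d] (c z) by exists z.
have [r /= r0 rO] : exists2 r : R, 0 < r &
    ball (c z) r `<=` [set c z | z in chart_dom c `&` chart_dom d].
  by have /nbhs_ballP[r] := open_nbhs_nbhs (conj oO Oz); exists r.
exists r; split; [exact: r0|by move=> t /rO[w [cw _] <-]; exists w|].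
have yy j t t' : ball (c z) r t -> ball (c z) r t' -> rsubmx t = rsubmx t' ->
    ycoord d (chart_inv c t) 0 j = ycoord d (chart_inv c t') 0 j.
  apply: (@partial_x_zero _ _ _ (fun t => ycoord d (chart_inv c t) 0 j) (c z) r).
    by move=> s /rO Os; exact: (smooth_differentiable oO (smooth_ycoord j sc sd)).
  by move=> s /rO[w [cw dw] <-] i; exact: (foliated_same_leaf fc fd).
move=> t t' bt bt' tt'.
have [w [cw dw] wt] := rO t bt; have [w' [cw' dw'] wt'] := rO t' bt'.
have Yw : ycoord d w = ycoord d w'.
  by apply/rowP => j; have := yy j t t' bt bt' tt'; rewrite -wt -wt' !chart_mapK.
have Jw : transverse_jacobian c d w = transverse_jacobian c d w'.
  apply/matrixP => i j; rewrite !mxE wt wt'.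
  exact: (partial_same_y (rshift p j) (yy i) r0 bt bt' tt').
have dE x : chart_dom d x -> covector_sqnorm d x = fun xi => sqnorm (symbol a (ycoord d x) xi).
  move=> dx; rewrite (covector_sqnorm_basic fd dx ba dx); apply/funext => xi.
  by rewrite transverse_jacobian_self // mulmx1.
rewrite -wt -wt' (chart_mapK cw) (chart_mapK cw') (normal_metric_change fc fd cw dw).
rewrite (normal_metric_change fc fd cw' dw') Jw !normal_metricE !cometricE.
by rewrite (dE _ dw) (dE _ dw') Yw.
Qed.

(** Stated at a point, so that it can be carried along the leaves from the transversal. *)
Definition smooth_at c z : Prop := exists U, [/\ open U, U (c z) &
  forall i j, smooth_on U (fun t => normal_metric c (chart_inv c t) i j)].

Lemma smooth_at_change c d z :
  foliated_chart F c -> foliated_chart F d -> chart_dom c z -> chart_dom d z ->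
  smooth_at d z -> smooth_at c z.
Proof.
move=> fc fd cz dz [U [oU Uz sU]].
have sc := foliated_smooth fc; have sd := foliated_smooth fd.
pose V := chart_dom d `&` d @^-1` U; have oV : open V by exact: chart_preimage_open.
pose W := [set c w | w in chart_dom c `&` (chart_dom d `&` V)].
have oW : open W by apply: chart_open; apply: openI => //; exact: chart_dom_open.
exists W; split=> //; first by exists z.
have sg k l : smooth_on W (fun t => normal_metric d (chart_inv c t) k l).
  apply: (@smooth_change _ _ _ _ _ _ (fun w => normal_metric d w k l)) => //.
    exact: smooth_chart_transition.
  by apply: smooth_on_sub (sU k l) => _ [w [_ [_ Uw]] <-].
have sJ k l : smooth_on W (fun t => transverse_jacobian c d (chart_inv c t) k l).
  apply: smooth_on_sub (smooth_transverse_jacobian k l sc sd).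
  by move=> _ [w [cw [dw _]] <-]; exists w.
move=> i j.
apply: (@smooth_on_eq _ _ _ _ (fun t => \sum_l (\sum_k
    transverse_jacobian c d (chart_inv c t) k i * normal_metric d (chart_inv c t) k l) *
    transverse_jacobian c d (chart_inv c t) l j)) => //.
  move=> _ [w [cw [dw _]] <-]; rewrite chart_mapK // (normal_metric_change fc fd cw dw).
  rewrite mxE; apply: eq_bigr => l _; congr (_ * _); rewrite mxE.
  by apply: eq_bigr => k _; rewrite mxE.
apply: (smooth_sum _ oW) => l; apply: (smoothM oW _ (sJ l j)).
by apply: (smooth_sum _ oW) => k; exact: (smoothM oW (sJ k i) (sg k l)).
Qed.

(** With constant coefficients the squared norm of covectors is the same function at all points of
    the chart, so the metric matrix is constant there. *)
Lemma smooth_at_constant z c (k : multi_index m -> R[i]) : chart_dom c z ->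
  basic_form F P c (fun s _ => k s) -> smooth_at c z.
Proof.
move=> cz bk; have fc : foliated_chart F c by case: bk.
have oI : open (chart_image c) by exact: chart_image_openT.
exists (chart_image c); split=> //; first by exists z.
move=> i j; apply: (smooth_on_eq oI _ (smooth_cst (normal_metric c z i j) oI)).
move=> _ [w cw <-]; rewrite chart_mapK //.
suff E : covector_sqnorm c w = covector_sqnorm c z.
  by rewrite !normal_metricE !cometricE E.
rewrite (covector_sqnorm_basic fc cw bk cw) (covector_sqnorm_basic fc cz bk cz).
by rewrite (transverse_jacobian_self cw) (transverse_jacobian_self cz).
Qed.

Lemma smooth_at_same_y c w w' r : ball (c w) r (c w') -> 0 < r ->
  (forall t t', ball (c w) r t -> ball (c w) r t' -> rsubmx t = rsubmx t' ->
      normal_metric c (chart_inv c t) = normal_metric c (chart_inv c t')) ->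
  ycoord c w = ycoord c w' -> (smooth_at c w <-> smooth_at c w').
Proof.
move=> bw' r0 gy yw; have bw : ball (c w) r (c w) by exact: ballxx.
pose G (ij : 'I_q * 'I_q) t := normal_metric c (chart_inv c t) ij.1 ij.2.
have Gy ij t t' : ball (c w) r t -> ball (c w) r t' -> rsubmx t = rsubmx t' -> G ij t = G ij t'.
  by move=> bt bt' tt'; rewrite /G (gy t t').
have key x x' : ball (c w) r (c x) -> ball (c w) r (c x') -> ycoord c x = ycoord c x' ->
    smooth_at c x -> smooth_at c x'.
  move=> bx bx' yx [U [oU Ux sU]].
  have [W [oW Wx' sW]] := smooth_translate Gy bx bx' yx oU Ux (fun ij => sU ij.1 ij.2).
  by exists W; split=> // i j; exact: (sW (i, j)).
by split; apply: key.
Qed.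

(** The radius in [normal_metric_same_y] depends on the point, so smoothness is only seen to be
    locally constant on the plaque; connectedness concludes. *)
Lemma smooth_at_plaque c u v : foliated_chart F c -> chart_dom c u -> plaque c u v ->
  chart_dom c v /\ (smooth_at c u <-> smooth_at c v).
Proof.
move=> fc cu Cv; set A := chart_dom c `&` [set w | ycoord c w = ycoord c u].
have CA w : plaque c u w -> A w by exact: connected_component_sub.
have Cu : plaque c u u by apply: connected_component_refl.
have key : forall x y, plaque c u x -> plaque c u y -> smooth_at c x -> smooth_at c y.
  apply: connected_locally_constant; first exact: component_connected.
  move=> w Cw; have [cw yw] := CA _ Cw.
  have [r [r0 _ gy]] := normal_metric_same_y fc cw.
  exists (chart_dom c `&` c @^-1` ball (c w) r); split.
  - by apply: chart_preimage_open; exact: ball_open.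
  - by split=> //; exact: ballxx.
  - move=> w' /CA[_ yw'] [_ bw']; apply: smooth_at_same_y gy _ => //.
    by rewrite yw yw'.
by have [cv _] := CA _ Cv; split=> //; split; apply: key.
Qed.

Lemma smooth_at_leaf z w : leaf F z w ->
  (forall c, foliated_chart F c -> chart_dom c w -> smooth_at c w) ->
  forall c, foliated_chart F c -> chart_dom c z -> smooth_at c z.
Proof.
(* All foliated charts are quantified over since consecutive plaques may come from different charts;
   an equivalence is proved since the leaf relation is symmetric. *)
pose S z := forall c, foliated_chart F c -> chart_dom c z -> smooth_at c z.
move=> zw; suff : S z <-> S w by case.
elim: zw => {z w} [z w [c [fc cz zw]]|z|z w _ [h1 h2]|x y z _ [h1 h2] _ [h3 h4]].
- have [cw [h1 h2]] := smooth_at_plaque fc cz zw.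
  split=> Sz d fd dz.
    by apply: (smooth_at_change fd fc dz cw); apply: h1; exact: Sz.
  by apply: (smooth_at_change fd fc dz cz); apply: h2; exact: Sz.
- by [].
- by split.
- by split=> [/h1/h3|/h4/h2].
Qed.

Lemma transverse_metric_normal_metric :
  (forall c z, foliated_chart F c -> chart_dom c z -> smooth_at c z) ->
  transverse_metric F normal_metric.
Proof.
move=> sm; split.
- move=> c fc i j; apply: smooth_on_local => _ [z cz <-].
  have [U [oU Uz sU]] := sm c z fc cz.
  by exists U, (fun t => normal_metric c (chart_inv c t) i j).
- by move=> c z fc cz; have [] := normal_metric_posdef fc cz.
- by move=> c z fc cz; have [] := normal_metric_posdef fc cz.
- by move=> c d z fc fd cz dz J; exact: normal_metric_change.
- move=> c z fc cz i a b; have [r [r0 _ gy]] := normal_metric_same_y fc cz.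
  apply: (partial_lshift0 i r0) => t t' bt bt' tt'.
  by rewrite (gy t t').
Qed.

End TransverseMetric.

End Foliations.

Theorem theorem2 (R : realType) (p q : nat) (M : manifold R (p + q))
    (F : foliation M) (m : nat) (P : Cinfty M -> Cinfty M) :
  compact [set: M] ->
  (2 <= m)%N ->
  basic_operator F m P ->
  transversely_elliptic F m P ->
  (exists (I : finType) (T : I -> set M),
    [/\ complete_transversal F T,
        admissible_transversal F m P T
      & constant_coefficients_on F m P (\bigcup_(i in [set: I]) T i)]) ->
  riemannian_foliation F.
Proof.
move=> _ m2 Pb Pe [I [T [[_ TF] _ Tc]]].
have m0 : (0 < m)%N by exact: leq_trans m2.
exists (normal_metric Pb); apply: transverse_metric_normal_metric => //.
move=> c z fc cz; have [i [w [Tw zw]]] := TF z.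
apply: (smooth_at_leaf m0 Pe zw) => // d fd dw.
have [|e [k [ew be]]] := Tc w; first by exists i.
have fe : foliated_chart F e by case: be.
(* Smoothness at [w] is known in the chart [e] with constant coefficients and passes to the
   arbitrary foliated chart [d]. *)
exact: (smooth_at_change m0 Pe fd fe dw ew (smooth_at_constant Pb ew be)).
Qed.
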